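(* Let $\mathfrak g$ be a complex simple Lie algebra and let $\mathbb F_\Theta=U/K_\Theta$ be an associated flag manifold. The normal metric is (up to homothety) the unique invariant metric on $\mathbb F_\Theta$ which is a $\mathcal G_1$ structure with respect to every invariant almost complex structure. That is, for an invariant metric $g$ on $\mathbb F_\Theta$, the pair $(g,J)$ is a $\mathcal G_1$ structure for every invariant almost complex structure $J$ on $\mathbb F_\Theta$ if and only if $g$ is normal.
   Context: Flag manifolds and t-roots. $\mathfrak h$ is a Cartan subalgebra of $\mathfrak g$, $R$ the root system, $B$ the Killing form, $H_\alpha\in\mathfrak h$ the element with $\alpha(X)=B(X,H_\alpha)$, $\mathfrak h_{\mathbb R}$ the real span of the $H_\alpha$, $\Sigma$ a simple system, $R^\pm$ the positive/negative roots. For $\Theta\subset\Sigma$: $R_\Theta=\langle\Theta\rangle\cap R$, $R_\Theta^{\pm}=R_\Theta\cap R^{\pm}$, $R_M=R\setminus R_\Theta$, $R_M^+=R_M\cap R^+$. $G$ is a Lie group with Lie algebra $\mathfrak g$, $P_\Theta$ the normalizer in $G$ of $\mathfrak p_\Theta=\mathfrak h\oplus\sum_{\alpha\in R^+}\mathfrak g_\alpha\oplus\sum_{\alpha\in R_\Theta^-}\mathfrak g_\alpha$, and $\mathbb F_\Theta=G/P_\Theta$. Fix a Weyl basis $X_\alpha\in\mathfrak g_\alpha$ ($B(X_\alpha,X_{-\alpha})=1$, $[X_\alpha,X_\beta]=n_{\alpha,\beta}X_{\alpha+\beta}$ with $n_{\alpha,\beta}$ real and nonzero iff $\alpha+\beta\in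 R$, $n_{\alpha,\beta}=-n_{-\alpha,-\beta}$). Put $\mathfrak u_\alpha=\mathrm{span}_{\mathbb R}\{X_\alpha-X_{-\alpha},\,i(X_\alpha+X_{-\alpha})\}$, $\mathfrak u=i\mathfrak h_{\mathbb R}\oplus\sum_{\alpha\in R^+}\mathfrak u_\alpha$ (a compact real form), $U\subset G$ the corresponding compact group, $K_\Theta=P_\Theta\cap U$, with Lie algebra $\mathfrak k_\Theta=i\mathfrak h_{\mathbb R}\oplus\sum_{\alpha\in R_\Theta^+}\mathfrak u_\alpha$. Then $\mathbb F_\Theta=U/K_\Theta$ with tangent space at the origin $\mathfrak m=\sum_{\alpha\in R_M^+}\mathfrak u_\alpha$. Put $\mathfrak t=\{H\in i\mathfrak h_{\mathbb R}:\alpha(H)=0\ \forall\alpha\in R_\Theta\}$, $k(\alpha)=\alpha|_{\mathfrak t}$; the t-roots are $R_t=k(R_M)$ and $R_t^+=k(R_M^+)$. One has $\mathfrak m=\bigoplus_{\xi\in R_t^+}\mathfrak m_\xi$ with $\mathfrak m_\xi=\sum_{\alpha\in R_M^+,\,k(\alpha)=\xi}\mathfrak u_\alpha$, irreducible pairwise inequivalent $\mathrm{ad}(\mathfrak k_\Theta)$-modules. Invariant almost complex structures. These are the linear maps $J:\mathfrak m\to\mathfrak m$ with $J^2=-\mathrm{Id}$ commuting with $\mathrm{ad}(L)$ for all $L\in\mathfrak k_\Theta$. Invariant metrics. These are the $\mathrm{ad}(\mathfrak k_\Theta)$-invariant inner products on $\mathfrak m$; they are exactly $g=-\sum_{\xi\in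 R_t^+}\lambda_\xi B|_{\mathfrak m_\xi\times\mathfrak m_\xi}$ with $\lambda_\xi>0$. The metric $g$ is normal if all $\lambda_\xi$ are equal, i.e. $g=-\lambda B|_{\mathfrak m\times\mathfrak m}$ for some $\lambda>0$. $\mathcal G_1$ structures. $(g,J)$ is a $\mathcal G_1$ structure if $g(N(X,Y),X)=0$ for all $X,Y\in\mathfrak m$, where $N$ is the Nijenhuis tensor, $-\tfrac12N(X,Y)=-[JX,JY]+[X,Y]+J[X,JY]+J[JX,Y]$ for $X,Y\in\mathfrak m$ (brackets projected to $\mathfrak m$). *)

(* Defs.v *)
From HB Require Import structures.
From mathcomp Require Import all_boot all_order all_algebra.
From mathcomp Require Import complex.
From mathcomp Require Import boolp classical_sets reals.

Set Implicit Arguments.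
Unset Strict Implicit.
Unset Printing Implicit Defensive.

Import Order.TTheory GRing.Theory Num.Theory.

Local Open Scope classical_set_scope.
Local Open Scope ring_scope.
Local Open Scope complex_scope.

HB.mixin Record hasLieBracket (K : fieldType) L of Vector K L := {
  lie : L -> L -> L;
  lie_linearl : forall y : L, linear (fun x : L => lie x y);
  lie_linearr : forall x : L, linear (lie x);
  lie_xx : forall x : L, lie x x = 0;
  lie_jacobi : forall x y z : L,
    lie x (lie y z) + lie y (lie z x) + lie z (lie x y) = 0
}.

#[short(type="lieAlgType")]
HB.structure Definition LieAlgebra (K : fieldType) :=
  {L of hasLieBracket K L & Vector K L}.

Section LieTheory.
Variables (K : fieldType) (L : lieAlgType K).

Definition ad (x : L) : 'End(L) := linfun (lie x).

Definition killing (x y : L) : K :=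
  \tr (passmx.mxof (vbasis {:L}) (vbasis {:L}) (ad x \o ad y)%VF).

Definition lie_ideal (I : {vspace L}) : Prop :=
  forall x y : L, y \in I -> lie x y \in I.

Definition simple_lie : Prop :=
  (exists x y : L, lie x y != 0) /\
  (forall I : {vspace L}, lie_ideal I -> I = 0%VS \/ I = fullv).

Definition lie_prod (U V : {vspace L}) : {vspace L} :=
  <<[seq lie u v | u <- vbasis U, v <- vbasis V]>>%VS.

Definition nilpotent_lie (h : {vspace L}) : Prop :=
  exists n : nat, iter n (lie_prod h) h = 0%VS.

Definition cartan_subalgebra (h : {vspace L}) : Prop :=
  [/\ forall x y : L, x \in h -> y \in h -> lie x y \in h,
      nilpotent_lie h &
      forall x : L, (forall y : L, y \in h -> lie x y \in h) -> x \in h].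

Definition dual (h : {vspace L}) := 'Hom(subvs_of h, K^o).

Variable h : {vspace L}.

Definition weight_vector (a : dual h) (v : L) : Prop :=
  forall H : subvs_of h, lie (vsval H) v = (a H : K) *: v.

Definition is_root (a : dual h) : Prop :=
  a != 0 /\ exists2 v : L, v != 0 & weight_vector a v.

Variable S : seq (dual h).

Definition nonneg_comb (a : dual h) : Prop :=
  exists n : 'I_(size S) -> nat, a = \sum_(i < size S) S`_i *+ n i.

Definition simple_system : Prop :=
  [/\ basis_of fullv S,
      forall a, a \in S -> is_root a &
      forall a, is_root a -> nonneg_comb a \/ nonneg_comb (- a)].

Definition positive_root (a : dual h) : Prop := is_root a /\ nonneg_comb a.

Variable Theta : seq (dual h).

Definition positive_root_in (a : dual h) : Prop :=
  positive_root a /\ a \in <<Theta>>%VS.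

Definition positive_root_compl (a : dual h) : Prop :=
  positive_root a /\ a \notin <<Theta>>%VS.

End LieTheory.

(* The flag manifold U/K_Theta enters through its isotropy data at the origin:
   the real Lie algebra k_Theta of K_Theta acting on the tangent space m_Theta.
   Real subspaces of the complex algebra L are sets closed under real linear
   combinations. *)
Section FlagManifold.
Variables (R : realType) (L : lieAlgType R[i]) (h : {vspace L}).

(* No constant is prescribed when a + b = 0, where the bracket is the element
   of h dual to a. The last clause says that, together with a basis
   of h, the X a for a a root form a basis of L. *)
Definition weyl_basis (X : dual h -> L) : Prop :=
  [/\ forall a, is_root a -> weight_vector a (X a),
      forall a, is_root a -> killing (X a) (X (- a)) = 1,
      exists n : dual h -> dual h -> R, forall a b, is_root a -> is_root b ->
        [/\ a + b != 0 -> lie (X a) (X b) = (n a b)%:C *: X (a + b),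
            n a b != 0 <-> is_root (a + b) &
            n a b = - n (- a) (- b)] &
      exists rts : seq (dual h), (forall a, a \in rts <-> is_root a) /\
        basis_of {:L} (vbasis h ++ [seq X a | a <- rts])].

Definition real_span (A : set L) : set L :=
  [set v | exists n (c : 'I_n -> R) (w : 'I_n -> L),
     (forall i, A (w i)) /\ v = \sum_(i < n) (c i)%:C *: w i].

Definition h_real : set L :=
  real_span [set v | v \in h /\ exists2 a : dual h, is_root a &
    forall H : subvs_of h, a H = killing (vsval H) v].

Variables (S Theta : seq (dual h)) (X : dual h -> L).

(* The sum of the u_a over the a satisfying P. *)
Definition sum_u (P : dual h -> Prop) : set L :=
  real_span [set v | exists2 a, P a &
    v = X a - X (- a) \/ v = 'i *: (X a + X (- a))].

Definition k_Theta : set L :=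
  [set v | exists x y : L, [/\ h_real x,
     sum_u (positive_root_in S Theta) y & v = 'i *: x + y]].

Definition m_Theta : set L := sum_u (positive_root_compl S Theta).

(* The component in m_Theta along k_Theta; it is only meaningful on the
   compact real form, the direct sum of k_Theta and m_Theta. *)
Definition proj_m (v : L) : L :=
  xget 0 [set w | m_Theta w /\ k_Theta (v - w)].

(* Tensors on m_Theta are functions on L of which only the values on m_Theta
   matter. *)
Definition invariant_acs (J : L -> L) : Prop :=
  [/\ forall x, m_Theta x -> m_Theta (J x),
      forall (c : R) x y, m_Theta x -> m_Theta y ->
        J (c%:C *: x + y) = c%:C *: J x + J y,
      forall x, m_Theta x -> J (J x) = - x &
      forall l x, k_Theta l -> m_Theta x -> J (lie l x) = lie l (J x)].

Definition invariant_metric (g : L -> L -> R) : Prop :=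
  [/\ forall x y, m_Theta x -> m_Theta y -> g x y = g y x,
      forall (c : R) x y z, m_Theta x -> m_Theta y -> m_Theta z ->
        g (c%:C *: x + y) z = c * g x z + g y z,
      forall x, m_Theta x -> x != 0 -> 0 < g x x &
      forall l x y, k_Theta l -> m_Theta x -> m_Theta y ->
        g (lie l x) y + g x (lie l y) = 0].

Definition normal_metric (g : L -> L -> R) : Prop :=
  exists2 lambda : R, 0 < lambda &
    forall x y, m_Theta x -> m_Theta y ->
      (g x y)%:C = - (lambda%:C * killing x y).

Definition lie_m (x y : L) : L := proj_m (lie x y).

Definition nijenhuis (J : L -> L) (x y : L) : L :=
  - 2 *: (- lie_m (J x) (J y) + lie_m x y
          + J (lie_m x (J y)) + J (lie_m (J x) y)).

Definition G1_structure (g : L -> L -> R) (J : L -> L) : Prop :=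
  forall x y, m_Theta x -> m_Theta y -> g (nijenhuis J x y) x = 0.

End FlagManifold.

(* Main.v *)
Require Import Defs.
From HB Require Import structures.
From mathcomp Require Import all_boot all_order all_algebra.
From mathcomp Require Import complex.
From mathcomp Require Import boolp classical_sets reals.
From mathcomp Require Import ring.

Set Implicit Arguments.
Unset Strict Implicit.
Unset Printing Implicit Defensive.

Import Order.TTheory GRing.Theory Num.Theory.

Local Open Scope ring_scope.
Local Open Scope complex_scope.

(* On root vectors an invariant metric is g = - lam_a B and an invariant almost
   complex structure is J X_a = i eps_a X_a, because the torus acts on the planes
   u_a by distinct rotations.  In particular J is skew for the Killing form B, which
   together with the invariance of B gives the G1 condition when g is normal.
   Conversely, if a + b + c = 0 in R_M, the t-roots of a, b, c are nonzero and sum to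
   zero, so some invariant J has eps_a = eps_b = eps_c = 1; then
   N (X_a, X_b) = -8 [X_a, X_b], and the polarized G1 condition forces
   lam_a = lam_b = lam_c.  Invariance of g under k_Theta gives lam_(a + b) = lam_a for
   b in R_Theta.  Hence root vectors of R_M with distinct values of lam commute, and
   the root vectors with a given value of lam generate an ideal as a Lie algebra: by
   simplicity lam is constant. *)

(** * Lie bracket and Killing form *)

(** The data live on real subspaces of a complex algebra, and [g] and [J] are functions constrained
    only on [m_Theta], whereas the decisive computations are with the complex root vectors. The
    passage between the two levels shapes the proof. The metric and the almost complex structures
    built from signs are written through operators [diag f], acting by [f a] on [X a]; an identity
    known on the real form is then extended complex linearly to root vectors, one argument at a
    time, where it becomes a scalar equation. Conversely, the rotation argument concerns forms that
    are bilinear over the reals only, so the speeds, values of roots on the elements $H_\alpha$,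
    must be real. The constants of a Weyl basis describe the bracket of [X a] and [X b] only for
    [a + b] nonzero, so this reality has to be derived. Likewise the projected bracket, defined by
    choice, has to be identified with a linear map, [pi_m]. *)

Section LieGeneral.
Variables (K : fieldType) (L : lieAlgType K).
Implicit Types (x y z : L) (c : K).

HB.instance Definition _ x := GRing.isLinear.Build K L L _ (lie x) (lie_linearr x).

Definition lier y x : L := lie x y.
Fact lier_linear y : linear (lier y). Proof. exact: lie_linearl. Qed.
HB.instance Definition _ y := GRing.isLinear.Build K L L _ (lier y) (lier_linear y).

Lemma lieDl x y z : lie (x + y) z = lie x z + lie y z.
Proof. exact: (linearD (lier z)). Qed.
Lemma lieZl c x z : lie (c *: x) z = c *: lie x z.
Proof. exact: (linearZZ (lier z)). Qed.
Lemma lieNl x z : lie (- x) z = - lie x z.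
Proof. exact: (linearN (lier z)). Qed.
Lemma lieBl x y z : lie (x - y) z = lie x z - lie y z.
Proof. exact: (linearB (lier z)). Qed.
Lemma lie0l z : lie 0 z = 0 :> L.
Proof. exact: (linear0 (lier z)). Qed.
Lemma lieDr x y z : lie z (x + y) = lie z x + lie z y.
Proof. exact: linearD. Qed.
Lemma lieZr c x z : lie z (c *: x) = c *: lie z x.
Proof. exact: linearZZ. Qed.
Lemma lieNr x z : lie z (- x) = - lie z x.
Proof. exact: linearN. Qed.
Lemma lieBr x y z : lie z (x - y) = lie z x - lie z y.
Proof. exact: linearB. Qed.
Lemma lie0r z : lie z 0 = 0 :> L.
Proof. exact: linear0. Qed.

Definition lie_bilin :=
  (lieDl, lieDr, lieBl, lieBr, lieNl, lieNr, lieZl, lieZr, lie0l, lie0r).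

Lemma lieC x y : lie x y = - lie y x.
Proof.
apply/eqP; rewrite -addr_eq0; apply/eqP; have := lie_xx (x + y).
by rewrite lieDl !lieDr !lie_xx add0r addr0.
Qed.

Lemma lie_lier x y z : lie x (lie y z) = lie (lie x y) z + lie y (lie x z).
Proof.
have /eqP := lie_jacobi x y z.
rewrite -addrA addr_eq0 => /eqP ->.
by rewrite opprD addrC -(lieC _ z) (lieC z x) lieNr opprK.
Qed.

Lemma adE x y : ad x y = lie x y.
Proof. exact: lfunE. Qed.

Lemma ad_linear : linear (@ad K L).
Proof.
by move=> c x y; apply/lfunP => z; rewrite !lfunE /= !lfunE /= adE lieDl lieZl.
Qed.

Definition lftrace (f : 'End(L)) : K :=
  \tr (passmx.mxof (vbasis fullv) (vbasis fullv) f).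

Fact lftrace_linear : linear (lftrace : 'End(L) -> K^o).
Proof. by move=> c f g; rewrite /lftrace passmx.mxof_linear; exact: linearP. Qed.
HB.instance Definition _ := GRing.isLinear.Build K 'End(L) K^o _
  (lftrace : 'End(L) -> K^o) lftrace_linear.

Lemma lftraceC (f g : 'End(L)) : lftrace (f \o g)%VF = lftrace (g \o f)%VF.
Proof. by rewrite /lftrace !(passmx.mxof_comp _ _ (vbasisP _)) mxtrace_mulC. Qed.

Lemma killingC x y : killing x y = killing y x.
Proof. exact: lftraceC. Qed.

Lemma killing_linearl y : linear ((@killing K L)^~ y : L -> K^o).
Proof.
move=> c x z; rewrite /killing ad_linear comp_lfunDl -comp_lfunZl.
exact: lftrace_linear.
Qed.

Fact killing_linearr x : linear (@killing K L x : L -> K^o).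
Proof. by move=> c y z; rewrite ![killing x _]killingC killing_linearl. Qed.

HB.instance Definition _ x :=
  GRing.isLinear.Build K L K^o _ (@killing K L x) (killing_linearr x).

Lemma killingDr x y z : killing z (x + y) = killing z x + killing z y.
Proof. exact: (linearD (_ : {linear _ -> K^o})). Qed.
Lemma killingZr c x z : killing z (c *: x) = c * killing z x.
Proof. exact: (linearZZ (_ : {linear _ -> K^o})). Qed.
Lemma killingNr x z : killing z (- x) = - killing z x.
Proof. exact: (linearN (_ : {linear _ -> K^o})). Qed.
Lemma killingBr x y z : killing z (x - y) = killing z x - killing z y.
Proof. exact: (linearB (_ : {linear _ -> K^o})). Qed.
Lemma killing0r z : killing z (0 : L) = 0.
Proof. exact: (linear0 (_ : {linear _ -> K^o})). Qed.
Lemma killingDl x y z : killing (x + y) z = killing x z + killing y z.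
Proof. by rewrite ![killing _ z]killingC killingDr. Qed.
Lemma killingZl c x z : killing (c *: x) z = c * killing x z.
Proof. by rewrite ![killing _ z]killingC killingZr. Qed.
Lemma killingNl x z : killing (- x) z = - killing x z.
Proof. by rewrite ![killing _ z]killingC killingNr. Qed.
Lemma killingBl x y z : killing (x - y) z = killing x z - killing y z.
Proof. by rewrite ![killing _ z]killingC killingBr. Qed.
Lemma killing0l z : killing (0 : L) z = 0.
Proof. by rewrite ![killing _ z]killingC killing0r. Qed.

Definition killing_bilin := (killingDl, killingDr, killingBl, killingBr,
  killingNl, killingNr, killingZl, killingZr, killing0l, killing0r).

Lemma ad_lie x y : ad (lie x y) = (ad x \o ad y)%VF - (ad y \o ad x)%VF.
Proof.
apply/lfunP => z; rewrite !lfun_simp /=.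
by rewrite lie_lier addrK.
Qed.

Lemma killingA x y z : killing (lie x y) z = killing x (lie y z).
Proof.
rewrite /killing !ad_lie comp_lfunDl comp_lfunDr comp_lfunNl comp_lfunNr.
rewrite -!/(lftrace _) !linearB /= !comp_lfunA; congr (_ - _).
by rewrite -!comp_lfunA lftraceC comp_lfunA.
Qed.

(** Inserting the identity as a change of basis and commuting the two factors under the trace shows
    that the basis does not matter; [killing_h] needs a basis of eigenvectors. *)
Lemma lftrace_basis n (e : n.-tuple L) (f : 'End(L)) : basis_of fullv e ->
  lftrace f = \sum_i coord e i (f e`_i).
Proof.
move=> eB; have en := size_basis eB; subst n.
rewrite -[f in LHS]comp_lfun1l /lftrace (passmx.mxof_comp _ _ eB) mxtrace_mulC.
rewrite -(passmx.mxof_comp _ _ (vbasisP _)) comp_lfun1r.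
by apply: eq_bigr => i _; rewrite !mxE /= passmx.vecof_delta.
Qed.
End LieGeneral.

(** * Roots and coroots *)

Section Roots.
Variables (R : realType) (L : lieAlgType R[i]).
Variables (h : {vspace L}) (S : seq (dual h)) (X : dual h -> L).
Hypothesis h_cartan : cartan_subalgebra h.
Hypothesis S_simple : simple_system S.
Hypothesis X_weyl : weyl_basis X.

Implicit Types (a b c d : dual h) (u v w : L).

(** Roots are functionals on the subtype of [h]; composition with the projection onto [h] lets them
    be evaluated at elements of [L] that are merely known to lie in [h]. *)
Definition ev a v : R[i] := a (vsproj h v).

Lemma evD a u v : ev a (u + v) = ev a u + ev a v.
Proof. by rewrite /ev !linearD. Qed.
Lemma evDl a b u : ev (a + b) u = ev a u + ev b u.
Proof. by rewrite /ev add_lfunE. Qed.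
Lemma evNl a u : ev (- a) u = - ev a u.
Proof. by rewrite /ev opp_lfunE. Qed.

Lemma X_weight a v : is_root a -> v \in h -> lie v (X a) = ev a v *: X a.
Proof.
move=> ra hv; have [/(_ a ra (vsproj h v)) + _ _ _] := X_weyl.
by rewrite vsprojK.
Qed.

Lemma killing_XN a : is_root a -> killing (X a) (X (- a)) = 1.
Proof. by have [_ + _ _] := X_weyl; apply. Qed.

Lemma X_neq0 a : is_root a -> X a != 0.
Proof.
move=> ra; apply/eqP => Xa0; have := killing_XN ra.
by rewrite Xa0 killing0l => /esym/eqP; rewrite oner_eq0.
Qed.

Lemma root_neq0 a : is_root a -> a != 0. Proof. by case. Qed.

Lemma dual_neq0 c : c != 0 -> exists2 v, v \in h & ev c v != 0.
Proof.
move=> /lfunPn[H]; rewrite zero_lfunE => cH.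
by exists (vsval H); rewrite ?subvsP// /ev vsvalK.
Qed.

(** The simple roots span the dual of [h], so [v] is killed by every functional, in particular by
    its own coordinates. *)
Lemma root_sep v : v \in h -> (forall a, is_root a -> ev a v = 0) -> v = 0.
Proof.
move=> hv v0; have [SB Sroot _] := S_simple.
have all0 a : ev a v = 0.
  have : a \in <<S>>%VS by rewrite (span_basis SB) memvf.
  move=> /(@coord_span _ _ _ (in_tuple S)) ->.
  rewrite /ev sum_lfunE big1// => i _; rewrite scale_lfunE.
  by rewrite -[X in _ *: X]/(ev S`_i v) v0 ?scaler0//; apply/Sroot/mem_nth.
suff: vsproj h v = 0 by move=> /(congr1 vsval); rewrite vsprojK.
rewrite [LHS](coord_vbasis (memvf _)) big1// => i _.
have := all0 (linfun (coord (vbasis fullv) i : subvs_of h -> R[i]^o)).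
by rewrite /ev lfunE /= => ->; rewrite scale0r.
Qed.

(** A Cartan subalgebra is only assumed nilpotent. But [X a] is a common eigenvector of [u] and [v],
    so every root vanishes on [lie u v], which lies in [h], and roots separate the points of [h]. *)
Lemma lie_h u v : u \in h -> v \in h -> lie u v = 0.
Proof.
move=> hu hv; have [hh _ _] := h_cartan.
apply: root_sep; first exact: hh.
move=> a ra; apply/eqP.
have /eqP := X_weight ra (hh _ _ hu hv).
have /eqP := lie_lier u v (X a).
rewrite -subr_eq (X_weight ra hu) (X_weight ra hv) !lieZr.
rewrite (X_weight ra hu) (X_weight ra hv) !scalerA mulrC subrr => /eqP <-.
by rewrite eq_sym scaler_eq0 (negPf (X_neq0 ra)) orbF.
Qed.

Lemma rootsP : exists rts : seq (dual h), uniq rts /\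
  (forall a, a \in rts <-> is_root a) /\
  basis_of {:L} (vbasis h ++ [seq X a | a <- rts]).
Proof.
have [_ _ _ [rts [rP rB]]] := X_weyl; exists rts; split; last by [].

by have /free_uniq := basis_free rB; rewrite cat_uniq => /and3P[_ _ /map_uniq].
Qed.

Lemma root_span_ind (U : {vspace L}) :
  (h <= U)%VS -> (forall a, is_root a -> X a \in U) -> U = fullv.
Proof.
move=> hU XU; have [rts [_ [rP /span_basis rB]]] := rootsP.
apply/eqP; rewrite eqEsubv subvf -rB span_cat subv_add.
rewrite (span_basis (vbasisP h)) hU; apply/span_subvP => _ /mapP[a /rP ra ->].
exact: XU.
Qed.

Lemma linear_root_eq0 (V : lmodType R[i]) (f : {linear L -> V}) :
  (forall v, v \in h -> f v = 0) -> (forall a, is_root a -> f (X a) = 0) ->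
  forall v, f v = 0.
Proof.
move=> fh fX v.
have [rts [_ [rP rB]]] := rootsP.
have /(@coord_span _ _ _ (in_tuple _)) -> :
    v \in <<vbasis h ++ [seq X a | a <- rts]>>%VS.
  by rewrite (span_basis rB) memvf.
rewrite linear_sum big1// => i _; rewrite linearZ /= .
have := mem_nth 0 (ltn_ord i); set w := nth _ _ _; rewrite /= mem_cat.
case/orP => [/vbasis_mem/fh ->|/mapP[a /rP/fX + ->]]; first by rewrite scaler0.
by move=> ->; rewrite scaler0.
Qed.

(** Invariance under [v] in [h] multiplies the pairing by [ev (a + b) v], which is nonzero for a
    suitable [v]. *)
Lemma killing_XX a b : is_root a -> is_root b -> a + b != 0 ->
  killing (X a) (X b) = 0.
Proof.
move=> ra rb /dual_neq0[v hv]; rewrite evDl => ab0.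
have : killing (lie (X a) v) (X b) = killing (X a) (lie v (X b)) by exact: killingA.
rewrite lieC !X_weight// !killing_bilin => /eqP.
rewrite eq_sym -subr_eq0 opprK -mulrDl addrC mulf_eq0 (negPf ab0) /=.
by move/eqP.
Qed.

Lemma killing_hX a v : is_root a -> v \in h -> killing v (X a) = 0.
Proof.
move=> ra hv; have [w hw aw] := dual_neq0 (root_neq0 ra).
have := killingA v w (X a); rewrite lie_h// X_weight// killing_bilin killingZr.
by move/esym/eqP; rewrite mulf_eq0 (negPf aw) => /eqP.
Qed.

(** Otherwise pairing with [X a] would vanish on [h] and on all root vectors, hence on [L], against
    the normalisation of [X a] and [X (- a)]. *)
Lemma rootN a : is_root a -> is_root (- a).
Proof.
move=> ra; apply: contrapT => nra.
suff: killing (X a) (X (- a)) = 0.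
  by rewrite killing_XN// => /eqP; rewrite oner_eq0.
apply: (linear_root_eq0 (f := @killing _ L (X a) : {linear _ -> _^o})) => [v hv|b rb].
  by rewrite /= killingC killing_hX.
apply: killing_XX => //; apply/eqP => ab; apply: nra.
by rewrite (addr0_eq ab).
Qed.

(** This is the element $H_a$ dual to [a] for the Killing form (see [killing_coroot]), without the
    usual factor $2/(a,a)$. *)
Definition coroot a := lie (X a) (X (- a)).

Lemma coroot_in a : is_root a -> coroot a \in h.
Proof.
move=> ra; have [_ _] := h_cartan; apply => v hv.
suff -> : lie (coroot a) v = 0 by rewrite mem0v.
rewrite lieC /coroot lie_lier (X_weight ra hv) (X_weight (rootN ra) hv).
by rewrite evNl !lie_bilin scaleNr addrN oppr0.
Qed.

Lemma killing_coroot a v : is_root a -> v \in h -> killing v (coroot a) = ev a v.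
Proof.
by move=> ra hv; rewrite -killingA X_weight// killingZl killing_XN// mulr1.
Qed.

Lemma coroot_sym a b : is_root a -> is_root b -> ev a (coroot b) = ev b (coroot a).
Proof.
move=> ra rb; rewrite -!killing_coroot//; try exact: coroot_in.
exact: killingC.
Qed.

(** If [a + b] vanished on all $H_d$, then by symmetry every root would vanish on $H_a + H_b$, which
    would be zero, and so would its dual [a + b]. The separating elements thus lie in the torus part
    of [k_Theta], up to the factor ['i]. *)
Lemma root_pair_sep a b : is_root a -> is_root b -> a + b != 0 ->
  exists2 d, is_root d & ev (a + b) (coroot d) != 0.
Proof.
move=> ra rb ab; apply: contrapT => N.
have N' d : is_root d -> ev (a + b) (coroot d) = 0.
  by move=> rd; apply: contrapT => /eqP ?; apply: N; exists d.
have ab0 : coroot a + coroot b = 0.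
  apply: root_sep; first by rewrite rpredD ?coroot_in.
  by move=> d rd; rewrite evD !(coroot_sym rd)// -evDl N'.
have [v hv] := dual_neq0 ab.
by rewrite evDl -!killing_coroot// -killingDr ab0 killing0r eqxx.
Qed.

(** In the basis formed by [vbasis h] and the root vectors, [ad u \o ad v] is diagonal: 0 on [h],
    since [h] is abelian, and [ev a u * ev a v] on [X a]. *)
Lemma killing_h u v : u \in h -> v \in h -> exists2 rts : seq (dual h),
  (forall a, a \in rts -> is_root a) &
  killing u v = \sum_(a <- rts) ev a u * ev a v.
Proof.
move=> hu hv; have [rts [_ [rP rB]]] := rootsP; exists rts; first by move=> a /rP.
set e := _ ++ _ in rB.
pose mu := nseq (size (vbasis h)) 0 ++ [seq ev a u * ev a v | a <- rts].
have size_mu : size mu = size e by rewrite !size_cat !size_map size_nseq.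
have mu_eigen i : (i < size e)%N -> lie u (lie v e`_i) = mu`_i *: e`_i.
  rewrite !nth_cat size_nseq size_cat size_map => ilt.
  case: ltnP => hi.
    by rewrite nth_nseq hi scale0r (lie_h hv) ?lie0r// vbasis_mem ?mem_nth.
  have jlt : (i - size (vbasis h) < size rts)%N by rewrite ltn_subLR.
  rewrite !(nth_map 0)//; set a := rts`_ _.
  have ra : is_root a by apply/rP/mem_nth.
  by rewrite (X_weight ra hv) lieZr (X_weight ra hu) scalerA mulrC.
rewrite -[LHS]/(lftrace (ad u \o ad v)%VF) (@lftrace_basis _ _ _ (in_tuple e))//.
transitivity (\sum_(i < size e) mu`_i).
  apply: eq_bigr => i _; rewrite comp_lfunE !adE /= mu_eigen ?ltn_ord// linearZ /=.
  by rewrite (@coord_free _ _ _ (in_tuple e) i i (basis_free rB)) eqxx mulr1.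
rewrite -size_mu -(big_mkord xpredT (fun i => mu`_i)) -(big_nth 0 xpredT id).
by rewrite big_cat big_nseq big_map /= iter_fix ?add0r.
Qed.

(** * Structure constants and reality of the roots on coroots *)

Variable n : dual h -> dual h -> R.
Hypothesis n_lie : forall a b, is_root a -> is_root b -> a + b != 0 ->
  lie (X a) (X b) = (n a b)%:C *: X (a + b).
Hypothesis n_neq0 : forall a b, is_root a -> is_root b ->
  n a b != 0 <-> is_root (a + b).
Hypothesis nNN : forall a b, is_root a -> is_root b -> n (- a) (- b) = - n a b.

Lemma n_eq0 a b : is_root a -> is_root b -> ~ is_root (a + b) -> n a b = 0.
Proof.
by move=> ra rb nr; apply: contrapT => /eqP /(n_neq0 ra rb).
Qed.

Lemma root_double a : is_root a -> ~ is_root (a + a).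
Proof.
move=> ra r2a; have := n_lie ra ra (root_neq0 r2a).
move/esym/eqP; rewrite lie_xx scaler_eq0 (negPf (X_neq0 r2a)) orbF.
rewrite (fmorph_eq0 (real_complex R)) => /eqP n0.
by have /(n_neq0 ra ra) := r2a; rewrite n0 eqxx.
Qed.

(** Going down by [a] and back up multiplies [X b] by a product of two structure constants. The
    Jacobi identity expresses [ev b (coroot a)] as the difference of these factors for [a] and for
    [- a]. *)
Lemma lie_XX_back a b : is_root a -> is_root b -> b - a != 0 -> exists2 r : R,
  lie (X a) (lie (X (- a)) (X b)) = r%:C *: X b & ~ is_root (b - a) -> r = 0.
Proof.
move=> ra rb ba; have rNa := rootN ra.
rewrite n_lie//; last by rewrite addrC.
rewrite lieZr addrC.
have [rba|nrba] := pselect (is_root (b - a)).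
  exists (n (- a) b * n a (b - a)) => //.
  by rewrite n_lie// ?(addrC a) subrK ?scalerA ?rmorphM// root_neq0.
by exists 0 => //; rewrite n_eq0// 1?addrC// !scale0r.
Qed.

Lemma ev_coroot_neq a b : is_root a -> is_root b -> b - a != 0 -> b + a != 0 ->
  ev b (coroot a) \is Num.real /\
  (~ is_root (b - a) -> ~ is_root (b + a) -> ev b (coroot a) = 0).
Proof.
move=> ra rb ba bDa.
have [r rE r0] := lie_XX_back ra rb ba.
have := lie_XX_back (rootN ra) rb; rewrite opprK => /(_ bDa)[s sE s0].
have : ev b (coroot a) = r%:C - s%:C.
  apply/eqP; rewrite -subr_eq0.
  have : (ev b (coroot a) - (r%:C - s%:C)) *: X b == 0.
    rewrite scalerBl scalerBl -X_weight ?coroot_in// -rE -sE lie_lier.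
    by rewrite addrK subrr.
  by rewrite scaler_eq0 (negPf (X_neq0 rb)) orbF.
move=> ->; split=> [|n1 n2]; last by rewrite r0// s0// subrr.
by rewrite rpredB//; apply/complex_realP; eexists.
Qed.

(* For [b] outside the [a]-line, the Jacobi identity expresses [b (coroot a)]
   through the real structure constants; [a (coroot a)] is the difference of two
   such values unless no [b +- a] is a root, and then it is the inverse of a
   natural number by the trace formula. *)
Lemma ev_coroot_real a b : is_root a -> is_root b -> ev b (coroot a) \is Num.real.
Proof.
move=> ra rb.
suff aa_real : ev a (coroot a) \is Num.real.
  have [/eqP|ba] := eqVneq (b - a) 0; first by rewrite subr_eq0 => /eqP ->.
  have [/eqP|bDa] := eqVneq (b + a) 0.
    by rewrite addr_eq0 => /eqP ->; rewrite evNl rpredN.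
  by have [] := ev_coroot_neq ra rb ba bDa.
have a0 := root_neq0 ra.
have [[c [rc ca cDa cra]]|isolated] := pselect (exists c, [/\ is_root c, c - a != 0,
    c + a != 0 & is_root (c + a)]).
  have ev_a : ev a (coroot a) = ev (c + a) (coroot a) - ev c (coroot a).
    by rewrite evDl addrC addKr.
  have [cReal _] := ev_coroot_neq ra rc ca cDa.
  rewrite ev_a rpredB//; have [] // := ev_coroot_neq ra cra.
    by rewrite addrK root_neq0.
  apply/eqP => c2; have cE : c = - (a + a).
    by apply/eqP; rewrite -addr_eq0 addrA c2.
  by apply: (root_double ra); rewrite -[a + a]opprK -cE; exact: rootN.
have iso0 c : is_root c -> c - a != 0 -> c + a != 0 -> ev c (coroot a) = 0.
  move=> rc ca cDa; have [_ H] := ev_coroot_neq ra rc ca cDa.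
  apply: H => r; last by apply: isolated; exists c.
  apply: isolated; exists (- c); split; first exact: rootN.
  - by rewrite -opprD oppr_eq0.
  - by rewrite addrC -opprB oppr_eq0.
  - by rewrite addrC -opprB; exact: rootN.
have hca := coroot_in ra.
have [rts rP] := killing_h hca hca.
rewrite killing_coroot// => tE.
have [k] : exists k : nat, \sum_(b' <- rts) ev b' (coroot a) * ev b' (coroot a) =
    k%:R * (ev a (coroot a) * ev a (coroot a)).
  elim: rts rP {tE} => [|c rts IH] rP; first by exists 0; rewrite big_nil mul0r.
  rewrite big_cons; have [|k ->] := IH.
    by move=> b' b'in; apply: rP; rewrite inE b'in orbT.
  have rc : is_root c by apply: rP; rewrite mem_head.
  have [/eqP|ca] := eqVneq (c - a) 0.
    by rewrite subr_eq0 => /eqP ->; exists k.+1; rewrite mulrSr mulrDl mul1r addrC.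
  have [/eqP|cDa] := eqVneq (c + a) 0.
    rewrite addr_eq0 => /eqP ->; exists k.+1.
    by rewrite evNl mulrNN mulrSr mulrDl mul1r addrC.
  by exists k; rewrite iso0// mul0r add0r.
rewrite -tE => kE; have [->//|t0] := eqVneq (ev a (coroot a)) 0.
have kt1 : k%:R * ev a (coroot a) = 1.
  by apply: (mulIf t0); rewrite mul1r -mulrA.
have k0 : k%:R != 0 :> R[i].
  by apply: contra_eq_neq kt1 => ->; rewrite mul0r eq_sym oner_eq0.
have -> : ev a (coroot a) = k%:R^-1.
  by apply: (mulfI k0); rewrite kt1 mulfV.
by rewrite rpredV realn.
Qed.

(** * Generators of the compact real form *)

Definition rA a : L := X a - X (- a).
Definition rS a : L := 'i *: (X a + X (- a)).

Lemma rAN a : rA (- a) = - rA a.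
Proof. by rewrite /rA opprK opprB. Qed.

Lemma rSN a : rS (- a) = rS a.
Proof. by rewrite /rS opprK addrC. Qed.

Lemma mulii : 'i * 'i = -1 :> R[i].
Proof. by rewrite -expr2 sqrCi. Qed.

Lemma scaleCi (z : R[i]) (v : L) : z *: ('i *: v) = 'i *: (z *: v).
Proof. by rewrite !scalerA mulrC. Qed.

Lemma scale2r (v : L) : (2 : R[i]) *: v = v + v.
Proof. by rewrite scaler_nat mulr2n. Qed.

Lemma X_rAS a : X a = 2^-1 *: (rA a - 'i *: rS a).
Proof.
rewrite /rS scalerA mulii scaleN1r opprK /rA addrACA addNr addr0.
by rewrite -[X a + X a]scale2r scalerA mulVf ?scale1r// pnatr_eq0.
Qed.

Lemma lie_coroot_rA a v : is_root a -> v \in h ->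
  lie ('i *: v) (rA a) = ev a v *: rS a.
Proof.
move=> ra hv; rewrite /rA lieZl lieBr !X_weight//; last exact: rootN.
by rewrite evNl scaleNr opprK -scalerDr scalerA mulrC -scalerA.
Qed.

Lemma lie_coroot_rS a v : is_root a -> v \in h ->
  lie ('i *: v) (rS a) = - (ev a v *: rA a).
Proof.
move=> ra hv; rewrite /rS lieZl lieZr lieDr !X_weight//; last exact: rootN.
by rewrite evNl scaleNr -scalerBr scalerA mulii scaleN1r.
Qed.

Section Brackets.
Variables a b : dual h.
Hypotheses (ra : is_root a) (rb : is_root b).

Lemma lie_rArS : lie (rA a) (rS a) = ('i * 2) *: coroot a.
Proof.
rewrite /rA /rS lieZr lieBl !lieDr !lie_xx add0r addr0 [lie (X (- a)) _]lieC.
by rewrite opprK -scale2r scalerA.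
Qed.

Hypotheses (ab : a + b != 0) (aNb : a - b != 0).

Let nPN : n (- a) b = - n a (- b).
Proof. by rewrite -(nNN ra (rootN rb)) opprK. Qed.

Let lieNX : lie (X (- a)) (X b) = - ((n a (- b))%:C *: X (- (a - b))).
Proof.
rewrite n_lie// ?nPN ?rmorphN ?scaleNr 1?opprB 1?addrC //; first exact: rootN.
by rewrite -opprB oppr_eq0.
Qed.

Let lieXN : lie (X a) (X (- b)) = (n a (- b))%:C *: X (a - b).
Proof. by rewrite n_lie//; exact: rootN. Qed.

Let lieNN : lie (X (- a)) (X (- b)) = - ((n a b)%:C *: X (- (a + b))).
Proof.
rewrite n_lie ?nNN ?opprD ?rmorphN ?scaleNr//; try exact: rootN.
by rewrite -opprD oppr_eq0.
Qed.

(** The relation [n (- a) (- b) = - n a b] is what lets the four brackets recombine into real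
    generators with real coefficients, here and in the next two lemmas. Where [a + b] or [a - b] is
    not a root, its coefficient is zero. *)
Lemma lie_rArA :
  lie (rA a) (rA b) = (n a b)%:C *: rA (a + b) - (n a (- b))%:C *: rA (a - b).
Proof.
rewrite /rA lieBl !lieBr n_lie// lieNX lieXN lieNN !scalerBr.
move: (X (- (a - b))) (X (- (a + b))) => Y Z.
rewrite opprK [- (- _ + _)]opprD opprK opprB addrACA [RHS]addrACA.
by rewrite [X in _ + X = _]addrC.
Qed.

Lemma lie_rArS_neq :
  lie (rA a) (rS b) = (n a b)%:C *: rS (a + b) + (n a (- b))%:C *: rS (a - b).
Proof.
rewrite /rA /rS lieZr lieBl !lieDr n_lie// lieNX lieXN lieNN.
rewrite !scaleCi -scalerDr; congr (_ *: _).
move: (X (- (a - b))) (X (- (a + b))) => Y Z.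
by rewrite !scalerDr opprD !opprK [X in _ + X = _]addrC addrACA.
Qed.

Lemma lie_rSrS :
  lie (rS a) (rS b) = - ((n a b)%:C *: rA (a + b)) - (n a (- b))%:C *: rA (a - b).
Proof.
rewrite /rA /rS lieZl lieZr lieDl !lieDr n_lie// lieNX lieXN lieNN scalerA mulii.
rewrite scaleN1r -[RHS]opprD; congr (- _).
move: (X (- (a - b))) (X (- (a + b))) => Y Z.
by rewrite !scalerBr [X in _ + X = _]addrC addrACA.
Qed.

End Brackets.

(** * Real subspaces *)

Definition rsubspace (P : set L) :=
  P 0 /\ forall (c : R) x y, P x -> P y -> P (c%:C *: x + y).

Section RealSubspace.
Variables (P : set L).
Hypothesis P_rsub : rsubspace P.

Lemma rsub0 : P 0. Proof. by case: P_rsub. Qed.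
Lemma rsubD x y : P x -> P y -> P (x + y).
Proof. by move=> Px Py; have := P_rsub.2 1 x y Px Py; rewrite scale1r. Qed.
Lemma rsubZ (c : R) x : P x -> P (c%:C *: x).
Proof. by move=> Px; have := P_rsub.2 c x 0 Px rsub0; rewrite addr0. Qed.
Lemma rsubN x : P x -> P (- x).
Proof. by move=> /(rsubZ (-1)); rewrite rmorphN scaleN1r. Qed.
Lemma rsubB x y : P x -> P y -> P (x - y).
Proof. by move=> Px /rsubN; exact: rsubD. Qed.

Lemma real_span_min (A : set L) : (forall x, A x -> P x) ->
  forall x, real_span A x -> P x.
Proof.
move=> AP _ [k [c [w [Aw ->]]]]; elim/big_ind: _ => [|x y|i _].
- exact: rsub0.
- exact: rsubD.
- exact/rsubZ/AP.
Qed.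
End RealSubspace.

Lemma real_span_mem (A : set L) x : A x -> real_span A x.
Proof.
move=> Ax; exists 1, (fun=> 1), (fun=> x); split=> //.
by rewrite big_ord1 scale1r.
Qed.

Lemma real_span_rsub (A : set L) : rsubspace (real_span A).
Proof.
split; first by exists 0, (fun=> 0), (fun=> 0); split=> [[]//|]; rewrite big_ord0.
move=> r _ _ [k [c [w [Aw ->]]]] [l [d [u [Au ->]]]].
exists (k + l)%N, (fun i => match split i with inl j => r * c j | inr j => d j end),
  (fun i => match split i with inl j => w j | inr j => u j end); split.
  by move=> i; case: (split i).
rewrite big_split_ord scaler_sumr; congr (_ + _); apply: eq_bigr => i _.
  by rewrite (unsplitK (inl _ i)) rmorphM scalerA.
by rewrite (unsplitK (inr _ i)).
Qed.

(** * The isotropy algebra and the tangent space *)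

Variable Theta : seq (dual h).
Hypothesis sTheta : {subset Theta <= S}.

(** $R_M$ and, below, $R_\Theta$ with both signs, although [m_Theta] and [k_Theta] are spanned over
    positive roots: sums and opposites of roots then need no sign bookkeeping. *)
Definition inM a := is_root a /\ a \notin <<Theta>>%VS.
Definition inT a := is_root a /\ a \in <<Theta>>%VS.
Local Notation mm := (m_Theta S Theta X).
Local Notation kk := (k_Theta S Theta X).

Lemma inMN a : inM a -> inM (- a).
Proof. by move=> [ra a0]; split; [exact: rootN|rewrite rpredN]. Qed.
Lemma inTN a : inT a -> inT (- a).
Proof. by move=> [ra a0]; split; [exact: rootN|rewrite rpredN]. Qed.

Lemma m_rsub : rsubspace mm. Proof. exact: real_span_rsub. Qed.
Lemma sum_u_rsub (P : dual h -> Prop) : rsubspace (sum_u X P).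
Proof. exact: real_span_rsub. Qed.

Lemma m_rA a : inM a -> mm (rA a).
Proof.
move=> [ra aT]; have [_ _ /(_ a ra)[ap|ap]] := S_simple.
  by apply: real_span_mem; exists a; [split|left].
rewrite -[a]opprK rAN; apply: (rsubN m_rsub); apply: real_span_mem.
by exists (- a); [split; [split=> //; exact: rootN|rewrite rpredN]|left].
Qed.

Lemma m_rS a : inM a -> mm (rS a).
Proof.
move=> [ra aT]; have [_ _ /(_ a ra)[ap|ap]] := S_simple.
  by apply: real_span_mem; exists a; [split|right].
rewrite -rSN; apply: real_span_mem.
by exists (- a); [split; [split=> //; exact: rootN|rewrite rpredN]|right].
Qed.

Lemma m_ind (P : set L) : rsubspace P ->
  (forall a, inM a -> P (rA a)) -> (forall a, inM a -> P (rS a)) ->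
  forall x, mm x -> P x.
Proof.
move=> Pr PA PS; apply: (real_span_min Pr) => _ [a [[ra ap] aT] [->|->]].
  exact: PA.
exact: PS.
Qed.

Lemma h_real_in v : h_real h v -> v \in h.
Proof.
apply: (@real_span_min (fun u => u \in h)) => [|x []//]; split; first exact: mem0v.
by move=> c x y hx hy; rewrite rpredD// rpredZ.
Qed.

Lemma h_real_rsub : rsubspace (h_real h). Proof. exact: real_span_rsub. Qed.

Lemma h_real_coroot a : is_root a -> h_real h (coroot a).
Proof.
move=> ra; apply: real_span_mem; split; first exact: coroot_in.
exists a => // H; rewrite killing_coroot ?subvsP//.
by rewrite /ev vsvalK.
Qed.

Lemma k_rsub : rsubspace kk.
Proof.
split.
  exists 0, 0; split; [exact: (rsub0 h_real_rsub)|exact: (rsub0 (sum_u_rsub _))|].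
  by rewrite scaler0 addr0.
move=> c _ _ [x [y [hx hy ->]]] [x' [y' [hx' hy' ->]]].
exists (c%:C *: x + x'), (c%:C *: y + y'); split.
- exact: h_real_rsub.2.
- exact: (sum_u_rsub _).2.
- by rewrite !scalerDr !scalerA [_ * 'i]mulrC addrACA.
Qed.

Lemma k_coroot a : is_root a -> kk ('i *: coroot a).
Proof.
move=> ra; exists (coroot a), 0; split; last by rewrite addr0.
- exact: h_real_coroot.
- exact: (rsub0 (sum_u_rsub _)).
Qed.

Lemma k_sum_u y : sum_u X (positive_root_in S Theta) y -> kk y.
Proof.
move=> hy; exists 0, y; split=> //; last by rewrite scaler0 add0r.
exact: (rsub0 h_real_rsub).
Qed.

Lemma k_rA a : inT a -> kk (rA a).
Proof.
move=> [ra aT]; have [_ _ /(_ a ra)[ap|ap]] := S_simple.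
  by apply/k_sum_u/real_span_mem; exists a; [split|left].
rewrite -[a]opprK rAN; apply: (rsubN k_rsub); apply/k_sum_u/real_span_mem.
by exists (- a); [split; [split=> //; exact: rootN|rewrite rpredN]|left].
Qed.

Lemma k_rS a : inT a -> kk (rS a).
Proof.
move=> [ra aT]; have [_ _ /(_ a ra)[ap|ap]] := S_simple.
  by apply/k_sum_u/real_span_mem; exists a; [split|right].
rewrite -rSN; apply/k_sum_u/real_span_mem.
by exists (- a); [split; [split=> //; exact: rootN|rewrite rpredN]|right].
Qed.

(* [m_Theta] is a real form of the complex span of the [X a] with [inM a]; hence
   complex linear maps vanish on both or on none. *)
Lemma m_linear_eq0 (V : lmodType R[i]) (f : {linear L -> V}) :
  (forall a, inM a -> f (X a) = 0) -> forall x, mm x -> f x = 0.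
Proof.
move=> f0; apply: (@m_ind (fun u => f u = 0)) => [|a Ma|a Ma].
- by split=> [|c x y fx fy]; rewrite ?linear0// linearP fx fy scaler0 addr0.
- by rewrite /rA linearB (f0 _ Ma) (f0 _ (inMN Ma)) subr0.
- by rewrite /rS linearZZ linearD (f0 _ Ma) (f0 _ (inMN Ma)) addr0 scaler0.
Qed.

Lemma k_linear_eq0 (V : lmodType R[i]) (f : {linear L -> V}) :
  (forall v, v \in h -> f v = 0) -> (forall a, inT a -> f (X a) = 0) ->
  forall x, kk x -> f x = 0.
Proof.
move=> fh f0 _ [x [y [/h_real_in hx hy ->]]]; rewrite linearD linearZZ (fh _ hx).
rewrite scaler0 add0r; move: y hy; apply: (@real_span_min (fun u => f u = 0)).
  by split=> [|c u v fx fy]; rewrite ?linear0// linearP fx fy scaler0 addr0.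
move=> v [a [[ra _] aT] aE].
have Ta : inT a by []; have [f1 f2] := (f0 _ Ta, f0 _ (inTN Ta)).
case: aE => ->; first by rewrite linearB f1 f2 subr0.
by rewrite linearZZ linearD f1 f2 addr0 scaler0.
Qed.

Lemma X_linear_eq0 (V : lmodType R[i]) (f : {linear L -> V}) :
  (forall x, mm x -> f x = 0) -> forall a, inM a -> f (X a) = 0.
Proof.
move=> f0 a Ma; rewrite X_rAS linearZZ linearB linearZZ.
by rewrite (f0 _ (m_rA Ma)) (f0 _ (m_rS Ma)) scaler0 subr0 scaler0.
Qed.

(* Induces on the t-roots a functional that is positive on the positive ones. *)
Definition ht (a : dual h) : R[i] :=
  \sum_(i < size S | S`_i \notin <<Theta>>%VS) coord (in_tuple S) i a.

Lemma htD a b : ht (a + b) = ht a + ht b.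
Proof. by rewrite /ht -big_split; apply: eq_bigr => i _; rewrite linearD. Qed.

Lemma htN a : ht (- a) = - ht a.
Proof. by rewrite /ht -sumrN; apply: eq_bigr => i _; rewrite linearN. Qed.

Let S_free : free S. Proof. by case: S_simple => /basis_free. Qed.

Lemma ht_Theta a : a \in <<Theta>>%VS -> ht a = 0.
Proof.
move=> /(@coord_span _ _ _ (in_tuple Theta)) ->; apply: big1 => i iT.
rewrite linear_sum big1// => j _; rewrite linearZ /=.
set t := nth _ _ _; have tT : t \in Theta by apply: mem_nth.
have tS := sTheta tT; have ti : (index t S < size S)%N by rewrite index_mem.
have -> : t = (in_tuple S)`_(Ordinal ti) by rewrite nth_index.
rewrite coord_free//; case: eqP => [iE|_]; last by rewrite mulr0.
by move: iT; rewrite -(congr1 val iE) /= nth_index// memv_span.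
Qed.

Lemma ht_gt0 a : nonneg_comb S a -> a \notin <<Theta>>%VS -> 0 < ht a.
Proof.
move=> [m aE] aT.
have coordE i : coord (in_tuple S) i a = (m i)%:R.
  have -> : a = \sum_(i < size S) (m i)%:R *: (in_tuple S)`_i.
    by rewrite aE; apply: eq_bigr => j _; rewrite scaler_nat.
  exact: coord_sum_free.
have -> : ht a = (\sum_(i < size S | S`_i \notin <<Theta>>%VS) m i)%:R.
  by rewrite /ht natr_sum; apply: eq_bigr => i _; rewrite coordE.
rewrite ltr0n lt0n; apply: contra aT; rewrite sum_nat_eq0 => /forallP m0.
rewrite aE; apply: rpred_sum => i _.
have [iT|iT] := boolP (S`_i \in <<Theta>>%VS); first by rewrite rpredMn.
by have := m0 i; rewrite iT => /eqP ->; rewrite mulr0n rpred0.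
Qed.

Definition posM a := positive_root_compl S Theta a.

Lemma posM_inM a : posM a -> inM a. Proof. by case=> [[]]. Qed.

Lemma posM_D a b : posM a -> posM b -> a + b != 0.
Proof.
move=> [[_ a0] aT] [[_ b0] bT]; rewrite addr_eq0; apply/eqP => aE.
by have := ht_gt0 a0 aT; rewrite aE htN oppr_gt0 lt_gtF// ht_gt0.
Qed.

Lemma posM_ind (P : set L) : rsubspace P ->
  (forall a, posM a -> P (rA a) /\ P (rS a)) -> forall x, mm x -> P x.
Proof.
move=> Pr PA; apply: (real_span_min Pr) => _ [a ap [->|->]]; first exact: (PA a ap).1.
exact: (PA a ap).2.
Qed.

Lemma killing_real_gens a b : is_root a -> is_root b ->
  a + b != 0 -> a - b != 0 ->
  [/\ killing (rA a) (rA b) = 0, killing (rA a) (rS b) = 0,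
      killing (rS a) (rA b) = 0 & killing (rS a) (rS b) = 0].
Proof.
move=> ra rb ab aNb; have [rNa rNb] := (rootN ra, rootN rb).
have [k1 k2] := (killing_XX ra rb ab, killing_XX ra rNb aNb).
have k3 : killing (X (- a)) (X b) = 0.
  by apply: killing_XX => //; rewrite -oppr_eq0 opprD opprK.
have k4 : killing (X (- a)) (X (- b)) = 0.
  by apply: killing_XX => //; rewrite -oppr_eq0 opprD !opprK.
by split; rewrite /rA /rS !killing_bilin k1 k2 k3 k4;
  rewrite ?(subrr, addr0, mulr0).
Qed.

Lemma root_D_neq0 a : is_root a -> a + a != 0.
Proof.
move=> ra; apply/eqP => a2; have := root_neq0 ra.
suff -> : a = 0 by rewrite eqxx.
have : (2 : R[i]) *: a = 0 by rewrite scaler_nat mulr2n.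
by move/eqP; rewrite scaler_eq0 pnatr_eq0 /= => /eqP.
Qed.

Lemma killing_real_self a : is_root a ->
  [/\ killing (rA a) (rA a) = -2, killing (rA a) (rS a) = 0,
      killing (rS a) (rA a) = 0 & killing (rS a) (rS a) = -2].
Proof.
move=> ra; have a2 := root_D_neq0 ra.
have k1 := killing_XX ra ra a2.
have k2 : killing (X (- a)) (X (- a)) = 0.
  by apply: killing_XX; rewrite -?opprD ?oppr_eq0//; exact: rootN.
have k3 := killing_XN ra; have k4 : killing (X (- a)) (X a) = 1 by rewrite killingC.
split; rewrite /rA /rS !killing_bilin k1 k2 k3 k4; try ring.
by transitivity (2 * ('i * 'i) : R[i]); [ring|rewrite mulii mulrN1].
Qed.

(** * Diagonal operators and the projection onto the tangent space *)

Variable rts : seq (dual h).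
Hypothesis rts_uniq : uniq rts.
Hypothesis rtsP : forall a, a \in rts <-> is_root a.

(* Acts as [f a] on [X a] and as [0] on [h], because [killing v (X (- a))] is the
   coordinate of [v] along [X a]. *)
Definition diag (f : dual h -> R[i]) v : L :=
  \sum_(a <- rts) (f a * killing v (X (- a))) *: X a.

Fact diag_linear f : linear (diag f).
Proof.
move=> c u v; rewrite /diag scaler_sumr -big_split; apply: eq_bigr => a _ /=.
by rewrite !killing_bilin mulrDr scalerDl scalerA mulrCA.
Qed.
HB.instance Definition _ f :=
  GRing.isLinear.Build R[i] L L _ (diag f) (diag_linear f).

Lemma diag_h f v : v \in h -> diag f v = 0.
Proof.
move=> hv; rewrite /diag big1_seq// => a /andP[_ /rtsP ra].
by rewrite killing_hX ?mulr0 ?scale0r//; exact: rootN.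
Qed.

Lemma diag_X f a : is_root a -> diag f (X a) = f a *: X a.
Proof.
move=> ra; rewrite /diag (bigD1_seq a)//=; last exact/rtsP.
rewrite killing_XN// mulr1 big1_seq ?addr0// => b /andP[ba /rtsP rb].
rewrite killing_XX ?mulr0 ?scale0r//; first exact: rootN.
by rewrite subr_eq0 eq_sym.
Qed.

Lemma diag_linear_eq (f : dual h -> R[i]) (F : {linear L -> L}) :
  (forall a, inM a -> F (X a) = f a *: X a) -> forall x, mm x -> diag f x = F x.
Proof.
move=> FE x mx; apply/eqP; rewrite -subr_eq0; apply/eqP.
apply: (m_linear_eq0 (f := diag f \- F)) mx => a Ma.
by rewrite /= diag_X ?FE ?subrr//; case: Ma.
Qed.

(** A complex linear substitute for [proj_m], with which it agrees on brackets of elements of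
    [m_Theta] by [lie_mE]. *)
Definition pi_m : L -> L := diag (fun a => (`[< inM a >])%:R).

HB.instance Definition _ :=
  GRing.isLinear.Build R[i] L L _ pi_m (diag_linear _).

Lemma pi_X a : inM a -> pi_m (X a) = X a.
Proof.
by move=> Ma; rewrite /pi_m diag_X ?asboolT ?scale1r//; case: Ma.
Qed.

Lemma pi_id x : mm x -> pi_m x = x.
Proof.
move=> mx; rewrite [LHS](diag_linear_eq (F := idfun))// => a Ma.
by rewrite asboolT// scale1r.
Qed.

Lemma pi_XT a : is_root a -> ~ inM a -> pi_m (X a) = 0.
Proof. by move=> ra Ma; rewrite /pi_m diag_X ?asboolF ?scale0r. Qed.

Lemma inTM a : inT a -> ~ inM a.
Proof. by move=> [_ aT] [_ /negP]. Qed.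

Lemma root_MT a : is_root a -> inM a \/ inT a.
Proof.
by move=> ra; case: (boolP (a \in <<Theta>>%VS)) => aT; [right|left].
Qed.

Lemma pi_k x : kk x -> pi_m x = 0.
Proof.
apply: (k_linear_eq0 (f := pi_m)) => [v hv|a Ta]; first exact: diag_h.
by apply: pi_XT; [case: Ta|exact: inTM].
Qed.

(** The kernel of [pi_m] is orthogonal to [m_Theta]: [X a] pairs only with [X (- a)], and [- a] is
    in $R_M$ when [a] is. *)
Lemma killing_pi v x : mm x -> killing (pi_m v) x = killing v x.
Proof.
move=> mx; apply/eqP; rewrite -subr_eq0 -killingBl; apply/eqP.
apply: (m_linear_eq0 (f := (@killing _ L (pi_m v - v) : {linear L -> _^o}))) mx.
move=> a Ma /=; rewrite killingC.
pose F : {linear L -> (R[i])^o} := @killing _ L (X a) \o (pi_m \- idfun).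
have ra : is_root a by case: Ma.
apply: (linear_root_eq0 (f := F)) => [u hu|b rb]; rewrite /F /=.
  by rewrite /pi_m diag_h// sub0r killingNr killingC killing_hX// oppr0.
have [Mb|nMb] := pselect (inM b); first by rewrite pi_X// subrr killing0r.
rewrite pi_XT// sub0r killingNr killing_XX ?oppr0//.
apply/eqP => ab; apply: nMb.
have -> : b = - a by apply/eqP; rewrite -addr_eq0 addrC ab.
exact: inMN.
Qed.

(** * Brackets of tangent vectors lie in the compact real form *)

Definition in_mk v := exists2 w, mm w & kk (v - w).

Lemma mk_rsub : rsubspace in_mk.
Proof.
split; first by exists 0; rewrite ?subr0; [exact: rsub0 m_rsub|exact: rsub0 k_rsub].
move=> c u v [u' mu ku] [v' mv kv]; exists (c%:C *: u' + v'); first exact: m_rsub.2.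
by rewrite opprD addrACA -scalerBr; exact: k_rsub.2.
Qed.

Lemma mk_k x : kk x -> in_mk x.
Proof. by exists 0; rewrite ?subr0//; exact: rsub0 m_rsub. Qed.

Lemma mk_m x : mm x -> in_mk x.
Proof. by exists x; rewrite ?subrr//; exact: rsub0 k_rsub. Qed.

Lemma mk_nrA a b : is_root a -> is_root b -> in_mk ((n a b)%:C *: rA (a + b)).
Proof.
move=> ra rb; have [r|nr] := pselect (is_root (a + b)); last first.
  by rewrite n_eq0// scale0r; exact: rsub0 mk_rsub.
apply: (rsubZ mk_rsub); case: (root_MT r) => H; first exact/mk_m/m_rA.
exact/mk_k/k_rA.
Qed.

Lemma mk_nrS a b : is_root a -> is_root b -> in_mk ((n a b)%:C *: rS (a + b)).
Proof.
move=> ra rb; have [r|nr] := pselect (is_root (a + b)); last first.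
  by rewrite n_eq0// scale0r; exact: rsub0 mk_rsub.
apply: (rsubZ mk_rsub); case: (root_MT r) => H; first exact/mk_m/m_rS.
exact/mk_k/k_rS.
Qed.

Lemma mk_lie_gens a b : posM a -> posM b ->
  [/\ in_mk (lie (rA a) (rA b)), in_mk (lie (rA a) (rS b)),
      in_mk (lie (rS a) (rA b)) & in_mk (lie (rS a) (rS b))].
Proof.
move=> pa pb; have [[ra _] [rb _]] := (posM_inM pa, posM_inM pb).
have rNb := rootN rb; have rNa := rootN ra.
have ab := posM_D pa pb; have ba := posM_D pb pa.
have [/eqP|aNb] := eqVneq (a - b) 0.
  rewrite subr_eq0 => /eqP <-; rewrite !lie_xx [lie (rS a) _]lieC lie_rArS//.
  have : in_mk (('i * 2) *: coroot a).
    rewrite mulrC -scalerA -(rmorph_nat (real_complex R) 2).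
    by apply: (rsubZ mk_rsub); exact/mk_k/k_coroot.
  split=> //; try exact: (rsub0 mk_rsub); exact: (rsubN mk_rsub).
have bNa : b - a != 0 by rewrite -opprB oppr_eq0.
rewrite lie_rArA// lie_rArS_neq// lie_rSrS// [lie (rS a) _]lieC lie_rArS_neq//.
split.
- by apply: (rsubB mk_rsub); exact: mk_nrA.
- by apply: (rsubD mk_rsub); exact: mk_nrS.
- by apply/(rsubN mk_rsub)/(rsubD mk_rsub); exact: mk_nrS.
- by apply: (rsubB mk_rsub); [apply: (rsubN mk_rsub)|]; exact: mk_nrA.
Qed.

Lemma rsub_preim (f : {linear L -> L}) (P : set L) :
  rsubspace P -> rsubspace (fun x => P (f x)).
Proof.
by move=> [P0 PD]; split=> [|c x y fx fy]; rewrite ?linear0// linearP; exact: PD.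
Qed.

Lemma mk_lie x y : mm x -> mm y -> in_mk (lie x y).
Proof.
move=> mx my; apply: (posM_ind (P := fun x => in_mk (lie x y))) mx.
  exact: (rsub_preim (lier y) mk_rsub).
move=> a pa; split; apply: (posM_ind (P := fun y => in_mk (lie _ y))) my;
  try exact: (rsub_preim (@lie _ L _) mk_rsub).
  by move=> b pb; have [] := mk_lie_gens pa pb.
by move=> b pb; have [] := mk_lie_gens pa pb.
Qed.

(** The witness [w] keeps [xget] from its default 0, and any admissible choice equals [pi_m v],
    because [pi_m] is the identity on [m_Theta] and zero on [k_Theta]. *)
Lemma proj_mE v w : mm w -> kk (v - w) -> proj_m S Theta X v = pi_m v.
Proof.
move=> mw kw; rewrite /proj_m; case: xgetP => [u _ [mu ku]|/(_ w)]; last by case.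
have /eqP := pi_k ku; rewrite linearB subr_eq0 /= => /eqP ->.
by rewrite pi_id.
Qed.

Lemma lie_mE x y : mm x -> mm y -> lie_m S Theta X x y = pi_m (lie x y).
Proof. by move=> mx my; have [w mw kw] := mk_lie mx my; exact: (proj_mE mw kw). Qed.

Lemma pi_lie_m x y : mm x -> mm y -> mm (pi_m (lie x y)).
Proof.
move=> mx my; have [w mw kw] := mk_lie mx my.
have /eqP := pi_k kw; rewrite linearB subr_eq0 /= => /eqP ->.
by rewrite pi_id.
Qed.

(** * Invariant metrics and almost complex structures *)

(** Real bilinear but complex valued, so as to cover both the metric and the form
    [killing (J x) y]. *)
Definition m_bilin (phi : L -> L -> R[i]) :=
  (forall (c : R) x y z, mm x -> mm y -> mm z ->
    phi (c%:C *: x + y) z = c%:C * phi x z + phi y z) /\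
  (forall (c : R) x y z, mm x -> mm y -> mm z ->
    phi z (c%:C *: x + y) = c%:C * phi z x + phi z y).

(* The torus rotates [u_a] with speed [a], so invariance under it is a linear system
   whose determinants are [a + b] and [a - b]. *)
Section TorusInvariantForm.
Variable phi : L -> L -> R[i].
Hypothesis phi_bilin : m_bilin phi.
Hypothesis phi_inv : forall d x y, is_root d -> mm x -> mm y ->
  phi (lie ('i *: coroot d) x) y + phi x (lie ('i *: coroot d) y) = 0.

Let m0 : mm 0. Proof. exact: rsub0 m_rsub. Qed.
Let phiDl := phi_bilin.1.
Let phiDr := phi_bilin.2.

Lemma form_Zl (c : R) x z : mm x -> mm z -> phi (c%:C *: x) z = c%:C * phi x z.
Proof.
move=> mx mz; have := phiDl 1 m0 m0 mz; rewrite scale1r mul1r addr0.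
move=> /esym/eqP; rewrite -subr_eq0 addrK => /eqP p0.
by have := phiDl c mx m0 mz; rewrite p0 !addr0.
Qed.

Lemma form_Zr (c : R) x z : mm x -> mm z -> phi z (c%:C *: x) = c%:C * phi z x.
Proof.
move=> mx mz; have := phiDr 1 m0 m0 mz; rewrite scale1r mul1r addr0.
move=> /esym/eqP; rewrite -subr_eq0 addrK => /eqP p0.
by have := phiDr c mx m0 mz; rewrite p0 !addr0.
Qed.

Lemma form_Nl x z : mm x -> mm z -> phi (- x) z = - phi x z.
Proof.
by move=> mx mz; have := form_Zl (-1) mx mz; rewrite rmorphN scaleN1r mulN1r.
Qed.

Lemma form_Nr x z : mm x -> mm z -> phi z (- x) = - phi z x.
Proof.
by move=> mx mz; have := form_Zr (-1) mx mz; rewrite rmorphN scaleN1r mulN1r.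
Qed.

Let torus_rel a b d : inM a -> inM b -> is_root d ->
  let s := ev a (coroot d) in let t := ev b (coroot d) in
  [/\ s * phi (rS a) (rS b) = t * phi (rA a) (rA b),
      s * phi (rA a) (rA b) = t * phi (rS a) (rS b),
      s * phi (rS a) (rA b) = - (t * phi (rA a) (rS b)) &
      s * phi (rA a) (rS b) = - (t * phi (rS a) (rA b))].
Proof.
move=> Ma Mb rd s t; have [[ra _] [rb _]] := (Ma, Mb).
have hd := coroot_in rd.
(* Real linearity of [phi] lets the speeds be taken out only once they are known to be real. *)
have /complex_realP[s' sE] := ev_coroot_real rd ra.
have /complex_realP[t' tE] := ev_coroot_real rd rb.
have [[[mAa mSa] mAb] mSb] := (m_rA Ma, m_rS Ma, m_rA Mb, m_rS Mb).
have msA k := rsubZ m_rsub k mAa; have msS k := rsubZ m_rsub k mSa.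
have mtA k := rsubZ m_rsub k mAb; have mtS k := rsubZ m_rsub k mSb.
have e1 := phi_inv rd mAa mSb; have e2 := phi_inv rd mSa mAb.
have e3 := phi_inv rd mAa mAb; have e4 := phi_inv rd mSa mSb.
move: e1 e2 e3 e4.
rewrite !lie_coroot_rA// !lie_coroot_rS// /s /t sE tE.
rewrite ?form_Nl ?form_Nr ?form_Zl ?form_Zr// => e1 e2 e3 e4.
split; apply/eqP.
- by rewrite -subr_eq0 e1.
- by rewrite -subr_eq0 -oppr_eq0 opprB addrC e2.
- by rewrite -subr_eq0 opprK e3.
- by rewrite -subr_eq0 opprK -oppr_eq0 opprD e4.
Qed.

Lemma torus_add a b : inM a -> inM b -> a + b != 0 ->
  phi (rS a) (rS b) = phi (rA a) (rA b) /\ phi (rS a) (rA b) = - phi (rA a) (rS b).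
Proof.
move=> Ma Mb ab; have [d rd] := root_pair_sep Ma.1 Mb.1 ab.
have [] := torus_rel Ma Mb rd; rewrite evDl.
set s := ev a _; set t := ev b _ => e1 e2 e3 e4 st.
split; apply: (mulfI st); rewrite ?mulrN !mulrDl.
  by rewrite e1 -e2 addrC.
by rewrite e3 e4 opprD opprK addrC.
Qed.

Lemma torus_sub a b : inM a -> inM b -> a - b != 0 ->
  phi (rS a) (rS b) = - phi (rA a) (rA b) /\ phi (rS a) (rA b) = phi (rA a) (rS b).
Proof.
move=> Ma Mb ab; have [d rd] := root_pair_sep Ma.1 (rootN Mb.1) ab.
have [] := torus_rel Ma Mb rd; rewrite evDl evNl.
set s := ev a _; set t := ev b _ => e1 e2 e3 e4 st.
split; apply: (mulfI st); rewrite ?mulrN !mulrDl !mulNr.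
  by rewrite e1 -e2 opprB.
by rewrite e3 e4 addrC.
Qed.

Lemma torus_orth a b : inM a -> inM b -> a + b != 0 -> a - b != 0 ->
  [/\ phi (rA a) (rA b) = 0, phi (rA a) (rS b) = 0,
      phi (rS a) (rA b) = 0 & phi (rS a) (rS b) = 0].
Proof.
move=> Ma Mb ab aNb.
have [e1 e2] := torus_add Ma Mb ab; have [e3 e4] := torus_sub Ma Mb aNb.
have p0 : phi (rA a) (rA b) = 0.
  by apply/eqP; rewrite -eqNr -e3 e1.
have r0 : phi (rA a) (rS b) = 0.
  by apply/eqP; rewrite -eqNr -e2 e4.
by split; rewrite // ?e2 ?e1 ?p0 ?r0 ?oppr0.
Qed.

Lemma torus_self a : inM a ->
  phi (rS a) (rS a) = phi (rA a) (rA a) /\ phi (rS a) (rA a) = - phi (rA a) (rS a).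
Proof. by move=> Ma; apply: torus_add => //; apply/root_D_neq0/Ma.1. Qed.

End TorusInvariantForm.

Lemma m_bilin_eq (phi psi : L -> L -> R[i]) : m_bilin phi -> m_bilin psi ->
  (forall a b, posM a -> posM b ->
     [/\ phi (rA a) (rA b) = psi (rA a) (rA b),
         phi (rA a) (rS b) = psi (rA a) (rS b),
         phi (rS a) (rA b) = psi (rS a) (rA b) &
         phi (rS a) (rS b) = psi (rS a) (rS b)]) ->
  forall x y, mm x -> mm y -> phi x y = psi x y.
Proof.
move=> phiB psiB gen x y mx my; have m0 := rsub0 m_rsub.
(* Membership in [m_Theta] is carried along, since the forms are linear only there. *)
have sub_l z : mm z -> rsubspace (fun x => mm x /\ phi x z = psi x z).
  move=> mz; split=> [|c u v [mu eu] [mv e]].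
    by split=> //; rewrite -(scale0r (0 : L)) !form_Zl// !mul0r.
  by split; [exact: m_rsub.2|rewrite phiB.1// psiB.1// eu e].
have sub_r z : mm z -> rsubspace (fun x => mm x /\ phi z x = psi z x).
  move=> mz; split=> [|c u v [mu eu] [mv e]].
    by split=> //; rewrite -(scale0r (0 : L)) !form_Zr// !mul0r.
  by split; [exact: m_rsub.2|rewrite phiB.2// psiB.2// eu e].
suff [] : mm x /\ phi x y = psi x y by [].
apply: (posM_ind (sub_l y my)) mx => a pa.
have [mA mS] := (m_rA (posM_inM pa), m_rS (posM_inM pa)).
split; split=> //.
- suff [] : mm y /\ phi (rA a) y = psi (rA a) y by [].
  apply: (posM_ind (sub_r _ mA)) my => b pb; have [? ? _ _] := gen a b pa pb.
  by split; split=> //; [apply/m_rA/posM_inM|apply/m_rS/posM_inM].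
- suff [] : mm y /\ phi (rS a) y = psi (rS a) y by [].
  apply: (posM_ind (sub_r _ mS)) my => b pb; have [_ _ ? ?] := gen a b pa pb.
  by split; split=> //; [apply/m_rA/posM_inM|apply/m_rS/posM_inM].
Qed.

Lemma posM_cases a b : posM a -> posM b -> a = b \/ (a + b != 0 /\ a - b != 0).
Proof.
move=> pa pb; have [->|ab] := eqVneq a b; [by left|right].
by rewrite posM_D// subr_eq0.
Qed.

(** * The factors of an invariant metric *)

Section Metric.
Variable g : L -> L -> R.
Hypothesis g_inv : invariant_metric S Theta X g.

(** The factor of [g] against the negative of the Killing form on the plane $\mathfrak u_a$, where
    [rA a] has square norm 2 for the latter. It is indexed by roots, not t-roots. *)
Definition lam a : R[i] := (g (rA a) (rA a) / 2)%:C.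

Let gC x y : R[i] := (g x y)%:C.

Lemma metric_bilin : m_bilin gC.
Proof.
have [gC0 gl _ _] := g_inv; rewrite /gC; split=> c x y z mx my mz.
  by rewrite gl// rmorphD rmorphM.
have mxy := m_rsub.2 c _ _ mx my.
by rewrite gC0// gl// rmorphD rmorphM (gC0 x)// (gC0 y).
Qed.

Lemma metric_torus d x y : is_root d -> mm x -> mm y ->
  gC (lie ('i *: coroot d) x) y + gC x (lie ('i *: coroot d) y) = 0.
Proof.
move=> rd mx my; have [_ _ _ gk] := g_inv.
by rewrite -rmorphD gk ?rmorph0//; exact: k_coroot.
Qed.

Lemma lamN a : inM a -> lam (- a) = lam a.
Proof.
move=> Ma; have mA := m_rA Ma; have mNA := rsubN m_rsub mA.
rewrite /lam rAN; congr ((_ / 2)%:C); apply: complexI.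
by rewrite -!/(gC _ _) (form_Nl metric_bilin)// (form_Nr metric_bilin)// opprK.
Qed.

Lemma lam_gt0 a : inM a -> 0 < lam a.
Proof.
move=> Ma; have [_ _ gpos _] := g_inv.
rewrite /lam ltcR divr_gt0// gpos//; first exact: m_rA.
apply/eqP => A0; have [+ _ _ _] := killing_real_self Ma.1.
by rewrite A0 killing0r => /esym/eqP; rewrite oppr_eq0 pnatr_eq0.
Qed.

Lemma diag_rA f a : is_root a -> f (- a) = f a -> diag f (rA a) = f a *: rA a.
Proof.
move=> ra fN; rewrite /rA linearB /=.
by rewrite (diag_X f ra) (diag_X f (rootN ra)) fN scalerBr.
Qed.

Lemma diag_rS f a : is_root a -> f (- a) = f a -> diag f (rS a) = f a *: rS a.
Proof.
move=> ra fN; rewrite /rS linearZZ linearD /= (diag_X f ra) (diag_X f (rootN ra)) fN.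
by rewrite -scalerDr scaleCi.
Qed.

Lemma killing_bilin_m (F : {linear L -> L}) :
  m_bilin (fun x y => - killing (F x) y).
Proof.
split=> c x y z _ _ _.
  by rewrite linearP killingDl killingZl opprD mulrN.
by rewrite killingDr killingZr opprD mulrN.
Qed.

Lemma metric_diag x y : mm x -> mm y -> (g x y)%:C = - killing (diag lam x) y.
Proof.
apply: (m_bilin_eq metric_bilin (killing_bilin_m _)) => a b pa pb.
have [Ma Mb] := (posM_inM pa, posM_inM pb); have [ra rb] := (Ma.1, Mb.1).
rewrite /= !diag_rA ?lamN// !diag_rS ?lamN// !(killingZl (lam a)).
case: (posM_cases pa pb) => [<-|[ab aNb]]; last first.
  have [-> -> -> ->] := torus_orth metric_bilin metric_torus Ma Mb ab aNb.
  have [-> -> -> ->] := killing_real_gens ra rb ab aNb.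
  by rewrite mulr0 oppr0.
have [e1 e2] := torus_self metric_bilin metric_torus Ma.
have [-> -> -> ->] := killing_real_self ra.
have lamE : gC (rA a) (rA a) = - (lam a * -2).
  rewrite /lam mulrN opprK -(rmorph_nat (real_complex R) 2) -rmorphM.
  by rewrite divfK ?pnatr_eq0.
(* Torus invariance makes this value change sign when its arguments are exchanged, while [g] is
   symmetric. *)
have AS0 : gC (rA a) (rS a) = 0.
  apply/eqP; rewrite -eqNr -e2 /gC; have [-> //] := g_inv.
    exact: m_rS.
  exact: m_rA.
by rewrite e1 e2 lamE AS0 mulr0 oppr0.
Qed.

End Metric.

(** * Almost complex structures and sufficiency of normality *)

Section AlmostComplexStructure.
Variable J : L -> L.
Hypothesis J_inv : invariant_acs S Theta X J.

Let phi x y := killing (J x) y.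

Let phi_bilin : m_bilin phi.
Proof.
have [_ JL _ _] := J_inv; split=> c x y z mx my mz.
  by rewrite /phi JL// killingDl killingZl.
by rewrite /phi killingDr killingZr.
Qed.

Let phi_torus d x y : is_root d -> mm x -> mm y ->
  phi (lie ('i *: coroot d) x) y + phi x (lie ('i *: coroot d) y) = 0.
Proof.
move=> rd mx my; have [_ _ _ Jk] := J_inv.
by rewrite /phi Jk//; [rewrite lieC killingNl killingA addNr|exact: k_coroot].
Qed.

Lemma killing_m_real x y : mm x -> mm y -> killing x y \is Num.real.
Proof.
move=> mx my; have real_sub z : rsubspace (fun x => killing x z \is Num.real).
  split=> [|c u v ur vr]; first by rewrite killing0l.
  rewrite killingDl killingZl rpredD// rpredM//.
  by apply/complex_realP; exists c.
apply: (posM_ind (real_sub y)) mx => a pa.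
rewrite ![killing _ y]killingC.
split; apply: (posM_ind (real_sub _)) my => b pb.
  have [ra rb] := ((posM_inM pa).1, (posM_inM pb).1).
  case: (posM_cases pb pa) => [->|[ab aNb]].
    by have [-> _ -> _] := killing_real_self ra; rewrite rpredN realn.
  by have [-> _ -> _] := killing_real_gens rb ra ab aNb.
have [ra rb] := ((posM_inM pa).1, (posM_inM pb).1).
case: (posM_cases pb pa) => [->|[ab aNb]].
  by have [_ -> _ ->] := killing_real_self ra; rewrite rpredN realn.
by have [_ -> _ ->] := killing_real_gens rb ra ab aNb.
Qed.

Lemma m_nondeg z : mm z -> (forall x, mm x -> killing z x = 0) -> z = 0.
Proof.
move=> mz z0; rewrite -(pi_id mz) /pi_m /diag big1_seq// => a /andP[_ /rtsP ra].
case: (asboolP (inM a)) => [Ma|_]; last by rewrite mul0r scale0r.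
rewrite (X_linear_eq0 (f := (@killing _ L z : {linear L -> _^o})))//.
  by rewrite mulr0 scale0r.
exact: inMN.
Qed.

Lemma killing_lincomb (c d : R[i]) (x y z : L) :
  killing (c *: x + d *: y) z = c * killing x z + d * killing y z.
Proof. by rewrite killingDl !killingZl. Qed.

(* On [u_a] the real matrix of [J] commutes with the rotation sending [rA a] to
   [rS a] and [rS a] to [- rA a]; having square [-1], it is that rotation up to sign. *)
Lemma acs_rA_orth a : posM a -> phi (rA a) (rA a) = 0.
Proof.
move=> pa; have Ma := posM_inM pa; have ra := Ma.1.
have [mA mS] := (m_rA Ma, m_rS Ma); have [Jm JL JJ _] := J_inv.
have [kAA kAS kSA kSS] := killing_real_self ra.
have /complex_realP[p pE] := killing_m_real (Jm _ mA) mA.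
have /complex_realP[r rE] := killing_m_real (Jm _ mA) mS.
have JA : J (rA a) = (- p / 2)%:C *: rA a + (- r / 2)%:C *: rS a.
  set w := _ + _; have mw : mm w.
    by apply: (rsubD m_rsub); exact: (rsubZ m_rsub).
  apply/eqP; rewrite -subr_eq0; apply/eqP; apply: m_nondeg.
    by apply: (rsubB m_rsub) => //; exact: Jm.
  apply: posM_ind => [|b pb].
    split=> [|c x y x0 y0]; first by rewrite killing0r.
    by rewrite killingDr killingZr x0 y0 mulr0 addr0.
  have Mb := posM_inM pb; rewrite 2!killingBl /w !killing_lincomb.
  case: (posM_cases pa pb) => [<-|[ab aNb]].
    rewrite kAA kAS kSA kSS pE rE -(rmorph_nat (real_complex R) 2).
    by rewrite -rmorphN -!rmorphM !mulr0 addr0 add0r -!rmorphB;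
      split; apply/eqP; rewrite fmorph_eq0; apply/eqP; field.
  have [-> -> -> ->] := killing_real_gens ra Mb.1 ab aNb.
  have [eAA eAS _ _] := torus_orth phi_bilin phi_torus Ma Mb ab aNb.
  by rewrite -!/(phi _ _) eAA eAS !mulr0 addr0 subr0.
have [e1 e2] := torus_self phi_bilin phi_torus Ma.
have phiw z : mm z -> - killing (rA a) z =
    (- p / 2)%:C * phi (rA a) z + (- r / 2)%:C * phi (rS a) z.
  move=> mz; rewrite -killingNl -JJ// -/(phi _ _) [in LHS]JA.
  rewrite (phi_bilin.1 (- p / 2) _ _ _ mA)//; last exact: (rsubZ m_rsub).
  by rewrite (form_Zl phi_bilin).
have := phiw _ mA; have := phiw _ mS.
rewrite e1 e2 kAA kAS /phi pE rE -(rmorph_nat (real_complex R) 2).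
rewrite -!rmorphN -!rmorphM -!rmorphD oppr0 -(rmorph0 (real_complex R)).
move=> /complexI pr /complexI ppr; congr (_%:C).
(* The two equations say [p * r = 0] and [r ^+ 2 - p ^+ 2 = 4], so a nonzero [p] would have square
   -4. *)
have [//|p0] := eqVneq p 0.
have r0 : r = 0.
  have : p * r = 0 by rewrite -[RHS]oppr0 pr; field.
  by move/eqP; rewrite mulf_eq0 (negPf p0) => /eqP.
have : p ^+ 2 = - 4.
  by rewrite r0 in ppr; transitivity (-2 * - (- 2 : R) : R); [rewrite ppr; field|ring].
by move=> pp; have := sqr_ge0 p; rewrite pp oppr_ge0 lern0.
Qed.

(** Torus invariance makes [killing (J x) y] vanish between distinct planes and be antisymmetric off
    the diagonal within one plane; the diagonal vanishes by [acs_rA_orth]. *)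
Lemma acs_skew x y : mm x -> mm y -> killing (J x) y = - killing x (J y).
Proof.
rewrite [killing x _]killingC -/(phi _ _) -/(phi _ _); move: x y.
apply: (m_bilin_eq (psi := fun x y => - phi y x)) => //.
  split=> c x y z mx my mz; first by rewrite phi_bilin.2// opprD mulrN.
  by rewrite phi_bilin.1// opprD mulrN.
move=> a b pa pb; have [Ma Mb] := (posM_inM pa, posM_inM pb).
case: (posM_cases pa pb) => [<-|[ab aNb]].
  have [-> ->] := torus_self phi_bilin phi_torus Ma.
  by rewrite acs_rA_orth// oppr0 opprK.
have [-> -> -> ->] := torus_orth phi_bilin phi_torus Ma Mb ab aNb.
have [||-> -> -> ->] := torus_orth phi_bilin phi_torus Mb Ma; last by rewrite oppr0.
  by rewrite addrC.
by rewrite -oppr_eq0 opprB.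
Qed.

(** Moving [J] and [pi_m] across the Killing form $B$ leaves
    $-B([Jx,Jy],x)+B([x,y],x)-B([x,Jy],Jx)-B([Jx,y],Jx)$: the second and fourth terms vanish, and
    the other two cancel by invariance. *)
Lemma normal_G1 g : normal_metric S Theta X g -> G1_structure S Theta X g J.
Proof.
move=> [l l0 gE] x y mx my; have [Jm _ _ _] := J_inv.
have [mJx mJy] := (Jm _ mx, Jm _ my).
rewrite /nijenhuis !lie_mE//.
have mN : mm (- pi_m (lie (J x) (J y)) + pi_m (lie x y) + J (pi_m (lie x (J y)))
    + J (pi_m (lie (J x) y))).
  apply: (rsubD m_rsub); last exact/Jm/pi_lie_m.
  apply: (rsubD m_rsub); last exact/Jm/pi_lie_m.
  apply: (rsubD m_rsub); last exact: pi_lie_m.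
  exact/(rsubN m_rsub)/pi_lie_m.
have two : (2 : R[i]) = (2 : R)%:C by rewrite rmorph_nat.
apply: complexI; rewrite gE//; last first.
  by rewrite two -rmorphN; exact: (rsubZ m_rsub).
rewrite killingZl !killingDl killingNl !killing_pi//.
rewrite !acs_skew ?killing_pi//; try exact: pi_lie_m.
have k0 u v : killing (lie u v) u = 0.
  by rewrite lieC killingNl killingA lie_xx killing0r oppr0.
rewrite !k0 killingA (lieC (J y)) killingNr (killingC (J x)) opprK.
by rewrite addr0 oppr0 addr0 subrr !mulr0 oppr0.
Qed.

End AlmostComplexStructure.

(** * Necessity of normality *)

Lemma inMDT a b : inT b -> inM a -> is_root (b + a) -> inM (b + a).
Proof. by move=> [_ bT] [_ aT] r; split=> //; rewrite rpredDl. Qed.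

Lemma inTM_neq0 a b : inT b -> inM a -> b + a != 0.
Proof.
move=> [_ bT] [_ aT]; apply: contraNneq aT => ba.
by rewrite -(rpredDl _ bT) ba mem0v.
Qed.

Lemma n_real_neq0 a b : is_root a -> is_root b -> is_root (a + b) ->
  (n a b)%:C != 0 :> R[i].
Proof. by move=> ra rb /(n_neq0 ra rb) n0; rewrite fmorph_eq0. Qed.

Lemma diag_comm f l x :
  (forall a b, inT b -> inM a -> inM (b + a) -> f (b + a) = f a) ->
  kk l -> mm x -> diag f (lie l x) = lie l (diag f x).
Proof.
move=> fT kl mx; apply/eqP; rewrite -subr_eq0; apply/eqP.
pose F : {linear L -> L} := (diag f \o @lie _ L l) \- (@lie _ L l \o diag f).
apply: (m_linear_eq0 (f := F)) mx => a Ma; rewrite /F /= (diag_X f Ma.1).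
pose G : {linear L -> L} := (diag f \o lier (X a)) \- (lier (f a *: X a)).
apply: (k_linear_eq0 (f := G)) kl => [v hv|b Tb]; rewrite /G /= /lier.
  by rewrite lieZr (X_weight Ma.1 hv) linearZZ /= (diag_X f Ma.1) !scalerA mulrC subrr.
rewrite lieZr (n_lie Tb.1 Ma.1 (inTM_neq0 Tb Ma)).
have [r|nr] := pselect (is_root (b + a)); last first.
  by rewrite (n_eq0 Tb.1 Ma.1 nr) scale0r linear0 scaler0 subrr.
by rewrite linearZZ /= (diag_X f r) (fT _ _ Tb Ma (inMDT Tb Ma r)) !scalerA mulrC subrr.
Qed.

(** Oddness of [eps] makes the operator preserve the real form [m_Theta], squares equal to 1 give
    $J^2=-1$, and constancy along $R_\Theta$ gives commutation with [k_Theta]. *)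
Lemma acs_of_sign (eps : dual h -> R) :
  (forall a, inM a -> eps (- a) = - eps a) -> (forall a, eps a * eps a = 1) ->
  (forall a b, inT b -> inM a -> inM (b + a) -> eps (b + a) = eps a) ->
  invariant_acs S Theta X (diag (fun a => 'i * (eps a)%:C)).
Proof.
move=> epsN eps2 epsT; set f := fun _ => _.
have JA a : inM a -> diag f (rA a) = (eps a)%:C *: rS a.
  move=> Ma; rewrite /rA linearB /= (diag_X f Ma.1) (diag_X f (rootN Ma.1)) /f.
  by rewrite epsN// rmorphN mulrN scaleNr opprK -scalerDr mulrC -scalerA.
have JS a : inM a -> diag f (rS a) = (- eps a)%:C *: rA a.
  move=> Ma; rewrite /rS linearZZ linearD /= (diag_X f Ma.1) (diag_X f (rootN Ma.1)).
  rewrite /f epsN// rmorphN mulrN scaleNr -scalerBr scalerA mulrA mulii mulN1r.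
  by rewrite scaleNr.
split.
- move=> x mx; apply: (m_ind (P := fun x => mm (diag f x))) mx => [|a Ma|a Ma].
  + exact: (rsub_preim (diag f) m_rsub).
  + by rewrite JA//; exact/(rsubZ m_rsub)/m_rS.
  + by rewrite JS//; exact/(rsubZ m_rsub)/m_rA.
- by move=> c x y _ _; rewrite linearP.
- move=> x mx; pose F : {linear L -> L} := (diag f \o diag f) \+ idfun.
  apply/eqP; rewrite -subr_eq0 opprK; apply/eqP.
  apply: (m_linear_eq0 (f := F)) mx => a Ma.
  rewrite /F /= (diag_X f Ma.1) linearZZ /= (diag_X f Ma.1) scalerA /f mulrACA mulii.
  by rewrite -rmorphM eps2 mulr1 scaleN1r addNr.
- move=> l x kl mx; apply: diag_comm => // a b Tb Ma Mba.
  by rewrite /f epsT.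
Qed.

(* The sign [eps] is the sign of [ht], corrected on the t-roots of [al], [be],
   [- (al + be)] and their opposites; the correction is consistent because
   these three t-roots are nonzero and sum to [0]. *)
Lemma sign_exists al be : inM al -> inM be -> inM (al + be) ->
  exists eps : dual h -> R,
  [/\ forall a, inM a -> eps (- a) = - eps a, forall a, eps a * eps a = 1,
      forall a b, inT b -> inM a -> inM (b + a) -> eps (b + a) = eps a &
      [/\ eps al = 1, eps be = 1 & eps (- (al + be)) = 1]].
Proof.
move=> [_ alT] [_ beT] [_ abT].
pose tri := [:: al; be; - (al + be)].
pose near a := has (fun x => a - x \in <<Theta>>%VS) tri.
pose eps a : R := if near a then 1 else if near (- a) then -1 else
  if 0 < ht a then 1 else -1.
have half x : x + x \in <<Theta>>%VS -> x \in <<Theta>>%VS.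
  move=> xx; rewrite -[x]scale1r -(mulVf (_ : 2 != 0 :> R[i])) ?pnatr_eq0//.
  by rewrite -scalerA rpredZ// scaler_nat mulr2n.
(* Otherwise [x + y] would lie in the span of [Theta] for some [x], [y] in [tri]; but it is twice an
   element of [tri] or the opposite of the third one. *)
have nearN a : near a -> near (- a) = false.
  move=> /hasP[x xt ax]; apply/negP => /hasP[y yt ay].
  have : x + y \in <<Theta>>%VS.
    rewrite -rpredN; suff -> : - (x + y) = (a - x) + (- a - y) by rewrite rpredD.
    by rewrite addrACA subrr add0r opprD.
  move: xt yt; rewrite !inE => /or3P[]/eqP-> /or3P[]/eqP->; apply/negP.
  - by apply: contra alT; exact: half.
  - by [].
  - by rewrite opprD addrA subrr add0r rpredN.
  - by rewrite addrC.
  - by apply: contra beT; exact: half.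
  - by rewrite opprD addrCA subrr addr0 rpredN.
  - by rewrite opprD addrAC addNr add0r rpredN.
  - by rewrite opprD addrNK rpredN.
  - by apply: contra abT => /half; rewrite rpredN.
have nearT a b : b \in <<Theta>>%VS -> near (b + a) = near a.
  by move=> bT; apply: eq_has => x; rewrite -addrA rpredDl.
have ntri x : x \in tri -> near x.
  by move=> xt; apply/hasP; exists x; rewrite // subrr mem0v.
exists eps; split.
- move=> a [ra aT]; rewrite /eps opprK.
  have [na|_] := boolP (near a); first by rewrite nearN.
  have [_|_] := boolP (near (- a)); first by rewrite opprK.
  rewrite htN oppr_gt0.
  have [_ _ /(_ a ra)[ap|ap]] := S_simple.
    by have ha := ht_gt0 ap aT; rewrite ha (lt_gtF ha).
  have := ht_gt0 ap; rewrite rpredN htN oppr_gt0 => /(_ aT) ha.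
  by rewrite ha (lt_gtF ha) opprK.
- by move=> a; rewrite /eps; do 3?[case: ifP => _]; rewrite ?mulrNN mulr1.
- move=> a b [_ bT] _ _; rewrite /eps nearT// opprD nearT ?rpredN// htD.
  by rewrite ht_Theta// add0r.
- by split; rewrite /eps ntri// !inE eqxx ?orbT.
Qed.

Lemma X_gens_eq0 (V : lmodType R[i]) (F : {linear L -> V}) b :
  F (rA b) = 0 -> F (rS b) = 0 -> F (X b) = 0.
Proof.
by move=> FA FS; rewrite X_rAS linearZZ linearB linearZZ FA FS scaler0 subr0 scaler0.
Qed.

Lemma m_nrA a b : is_root a -> is_root b -> (is_root (a + b) -> inM (a + b)) ->
  mm ((n a b)%:C *: rA (a + b)) /\ mm ((n a b)%:C *: rS (a + b)).
Proof.
move=> ra rb Mab; have [r|nr] := pselect (is_root (a + b)).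
  by split; apply: (rsubZ m_rsub); [apply: m_rA|apply: m_rS]; exact: Mab.
by rewrite (n_eq0 ra rb nr) !scale0r; split; exact: rsub0 m_rsub.
Qed.

(** [metric_diag] represents [g] on [m_Theta] only, so the invariance of [g] can be rewritten
    through it once these brackets are known to stay there. *)
Lemma m_lie_T b x : inT b -> mm x -> mm (lie (rA b) x) /\ mm (lie (rS b) x).
Proof.
move=> Tb mx.
have gens a : inM a -> [/\ mm (lie (rA b) (rA a)), mm (lie (rA b) (rS a)),
    mm (lie (rS b) (rA a)) & mm (lie (rS b) (rS a))].
  move=> Ma; have [TNb MNa] := (inTN Tb, inMN Ma); have [ra rb] := (Ma.1, Tb.1).
  have [d1 d2] := (inTM_neq0 Tb Ma, inTM_neq0 Tb MNa).
  have [d3 d4] : a + b != 0 /\ a - b != 0 by rewrite addrC -opprB oppr_eq0.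
  have [m1 m2] := m_nrA rb ra (inMDT Tb Ma).
  have [m3 m4] := m_nrA rb MNa.1 (inMDT Tb MNa).
  have [|_ m5] := m_nrA ra rb; first by rewrite addrC; exact: inMDT.
  have [|_ m6] := m_nrA ra TNb.1; first by rewrite addrC; exact: inMDT.
  rewrite [lie (rS b) (rA a)]lieC lie_rArA// !lie_rArS_neq// lie_rSrS//; split.
  - exact: (rsubB m_rsub).
  - exact: (rsubD m_rsub).
  - by apply: (rsubN m_rsub); exact: (rsubD m_rsub).
  - by apply: (rsubB m_rsub) => //; exact: (rsubN m_rsub).
split; apply: (m_ind (P := fun x => mm (lie _ x))) mx => [|a Ma|a Ma].
- exact: (rsub_preim (@lie _ L _) m_rsub).
- by have [] := gens a Ma.
- by have [] := gens a Ma.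
- exact: (rsub_preim (@lie _ L _) m_rsub).
- by have [] := gens a Ma.
- by have [] := gens a Ma.
Qed.

(** * Relations between the factors of the metric *)

Section MetricRelations.
Variable g : L -> L -> R.
Hypothesis g_inv : invariant_metric S Theta X g.
Local Notation lam := (lam g).
Local Notation D := (diag lam).

Lemma metric_k l x y : kk l -> mm x -> mm y -> mm (lie l x) -> mm (lie l y) ->
  killing y (D (lie l x)) + killing (D x) (lie l y) = 0.
Proof.
move=> kl mx my mlx mly; have [_ _ _ gk] := g_inv.
have : (g (lie l x) y)%:C + (g x (lie l y))%:C = 0 by rewrite -rmorphD gk// rmorph0.
rewrite !metric_diag// => /eqP.
by rewrite -opprD oppr_eq0 killingC => /eqP.
Qed.

(** Invariance is extended to [X b] acting on [X a] and [X (- (b + a))], one argument at a time,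
    where it reads [(lam (b + a) - lam a) * n b a = 0]. *)
Lemma lam_T a b : inT b -> inM a -> inM (b + a) -> lam (b + a) = lam a.
Proof.
move=> Tb Ma Mba.
have e1 x y : mm x -> mm y ->
    killing y (D (lie (X b) x)) + killing (D x) (lie (X b) y) = 0.
  move=> mx my.
  have [[mAx mSx] [mAy mSy]] := (m_lie_T Tb mx, m_lie_T Tb my).
  pose F : {linear L -> (R[i])^o} := (@killing _ L y \o (D \o lier x)) \+
    (@killing _ L (D x) \o lier y).
  by apply: (X_gens_eq0 (F := F)); apply: metric_k => //; [exact: k_rA|exact: k_rS].
have e2 y : mm y ->
    killing y (D (lie (X b) (X a))) + killing (D (X a)) (lie (X b) y) = 0.
  move=> my; pose F : {linear L -> (R[i])^o} :=
    (@killing _ L y \o (D \o @lie _ L (X b))) \+ (@killing _ L (lie (X b) y) \o D).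
  rewrite [X in _ + X]killingC; apply: (X_linear_eq0 (f := F)) Ma => x mx.
  by rewrite /F /= [X in _ + X]killingC e1.
have : killing (X (- (b + a))) (D (lie (X b) (X a))) +
    killing (D (X a)) (lie (X b) (X (- (b + a)))) = 0.
  pose F : {linear L -> (R[i])^o} := (@killing _ L (D (lie (X b) (X a)))) \+
    (@killing _ L (D (X a)) \o @lie _ L (X b)).
  rewrite killingC; apply: (X_linear_eq0 (f := F)) (inMN Mba) => y my.
  by rewrite /F /= killingC e2.
rewrite (diag_X _ Ma.1) killingZl -killingA [lie (X a) _]lieC.
rewrite (n_lie Tb.1 Ma.1 (root_neq0 Mba.1)) linearZZ /= (diag_X _ Mba.1).
rewrite killingC !killingNl !killingZl (killing_XN Mba.1) => /eqP.
rewrite !mulr1 mulrN subr_eq0 mulrC => /eqP.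
exact/mulIf/(n_real_neq0 Tb.1 Ma.1 Mba.1).
Qed.

(** [PL] and [PR] present one bilinear map as linear in its first and in its second argument.
    Replacing [x] by [x + z] turns the condition, quadratic in [x], into a trilinear one, which then
    extends to root vectors argument by argument. *)
Lemma G1_polarized (PL PR : L -> {linear L -> L}) a b c :
  (forall x y, PL y x = PR x y) ->
  (forall x y, mm x -> mm y -> killing x (PR x y) = 0) ->
  inM a -> inM b -> inM c ->
  killing (X c) (PR (X a) (X b)) + killing (X a) (PR (X c) (X b)) = 0.
Proof.
move=> PE e0 Ma Mb Mc.
have e1 x y z : mm x -> mm y -> mm z -> killing z (PR x y) + killing x (PR z y) = 0.
  move=> mx my mz; have := e0 (x + z) y (rsubD m_rsub mx mz) my.
  rewrite -PE linearD !PE killingDl !killingDr e0// e0//.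
  by rewrite add0r addr0 addrC.
have e2 y z : mm y -> mm z ->
    killing z (PR (X a) y) + killing (X a) (PR z y) = 0.
  move=> my mz; pose F : {linear L -> (R[i])^o} :=
    (@killing _ L z \o PL y) \+ @killing _ L (PR z y).
  rewrite [X in _ + X]killingC -PE; apply: (X_linear_eq0 (f := F)) Ma => x mx.
  by rewrite /F /= [X in _ + X]killingC PE e1.
have e3 y : mm y -> killing (X c) (PR (X a) y) + killing (X a) (PR (X c) y) = 0.
  move=> my; pose F : {linear L -> (R[i])^o} :=
    @killing _ L (PR (X a) y) \+ (@killing _ L (X a) \o PL y).
  rewrite killingC -[PR (X c) y]PE; apply: (X_linear_eq0 (f := F)) Mc => x mx.
  by rewrite /F /= killingC PE e2.
pose F : {linear L -> (R[i])^o} :=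
  (@killing _ L (X c) \o PR (X a)) \+ (@killing _ L (X a) \o PR (X c)).
exact: (X_linear_eq0 (f := F)) Mb.
Qed.

Lemma lam_M al be : (forall J, invariant_acs S Theta X J ->
    G1_structure S Theta X g J) ->
  inM al -> inM be -> inM (al + be) -> lam (al + be) = lam al.
Proof.
move=> G1 Mal Mbe Mab.
have [eps [epsN eps2 epsT [eal ebe ega]]] := sign_exists Mal Mbe Mab.
have /G1 {}G1 := acs_of_sign epsN eps2 epsT.
have [Jm _ _ _] := acs_of_sign epsN eps2 epsT.
set f := fun _ => _ in Jm G1; pose J : {linear L -> L} := diag f.
(* The Nijenhuis tensor without its factor -2, made complex bilinear on all of [L] by [pi_m]. *)
pose N x y := pi_m (lie x y) - pi_m (lie (J x) (J y)) +
  (J (pi_m (lie x (J y))) + J (pi_m (lie (J x) y))).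
have mN x y : mm x -> mm y -> mm (N x y).
  move=> mx my; have [mJx mJy] := (Jm _ mx, Jm _ my).
  apply: (rsubD m_rsub).
    by apply: (rsubB m_rsub); exact: pi_lie_m.
  by apply: (rsubD m_rsub); exact/Jm/pi_lie_m.
have e0 x y : mm x -> mm y -> killing x (D (N x y)) = 0.
  move=> mx my; have [mJx mJy] := (Jm _ mx, Jm _ my).
  have := G1 x y mx my; rewrite /nijenhuis !lie_mE//.
  have -> : - pi_m (lie (diag f x) (diag f y)) + pi_m (lie x y) +
      diag f (pi_m (lie x (diag f y))) + diag f (pi_m (lie (diag f x) y)) = N x y.
    by rewrite /N -!addrA addrCA.
  have two : (2 : R[i]) = (2 : R)%:C by rewrite rmorph_nat.
  have m2N : mm (-2 *: N x y) by rewrite two -rmorphN; exact/(rsubZ m_rsub)/mN.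
  move=> gN; have := metric_diag g_inv m2N mx; rewrite gN rmorph0.
  rewrite linearZZ killingZl killingC => /esym/eqP.
  by rewrite oppr_eq0 mulf_eq0 oppr_eq0 pnatr_eq0 => /eqP.
pose PL y : {linear L -> L} := D \o (
  ((pi_m \o lier y) \- (pi_m \o (lier (J y) \o J)))
  \+ ((J \o (pi_m \o lier (J y))) \+ (J \o (pi_m \o (lier y \o J))))).
pose PR x : {linear L -> L} := D \o (
  ((pi_m \o @lie _ L x) \- (pi_m \o (@lie _ L (J x) \o J)))
  \+ ((J \o (pi_m \o (@lie _ L x \o J))) \+ (J \o (pi_m \o @lie _ L (J x))))).
have : killing (X (- (al + be))) (D (N (X al) (X be))) +
    killing (X al) (D (N (X (- (al + be))) (X be))) = 0.
  exact: (G1_polarized (PL := PL) (PR := PR)) Mal Mbe (inMN Mab).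
(* [J] is ['i] on [X a] and [X b] and [- 'i] on their bracket, so each of the four terms of [N]
   contributes one copy of the bracket. *)
have NX a b : inM a -> inM b -> inM (a + b) -> eps a = 1 -> eps b = 1 ->
    eps (a + b) = -1 -> N (X a) (X b) = 4 *: lie (X a) (X b).
  move=> Ma Mb Mc ea eb ec; set w := lie _ _.
  have wE : w = (n a b)%:C *: X (a + b) by exact: n_lie Ma.1 Mb.1 (root_neq0 Mc.1).
  have Jw : J w = - 'i *: w.
    rewrite wE linearZZ /J /= (diag_X f Mc.1) !scalerA mulrC; congr (_ * _ *: _).
    by rewrite /f ec rmorphN rmorph1 mulrN1.
  have piw : pi_m w = w by rewrite wE linearZZ /= pi_X.
  have JX c : is_root c -> eps c = 1 -> J (X c) = 'i *: X c.
    by move=> rc ec1; rewrite /J /= (diag_X f rc) /f ec1 rmorph1 mulr1.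
  rewrite /N (JX _ Ma.1 ea) (JX _ Mb.1 eb) !lieZl !lieZr -/w scalerA mulii.
  rewrite !linearZZ /= -/(J w) piw -/(J w) Jw scalerA mulrN mulii opprK.
  rewrite scaleN1r scale1r opprK (_ : (4 : R[i]) = 1 + 1 + (1 + 1)); last by ring.
  by rewrite !scalerDl scale1r.
have gaE : - (al + be) + be = - al by rewrite opprD subrK.
have Mga := inMN Mab; have rab := root_neq0 Mab.1.
have Mgb : inM (- (al + be) + be) by rewrite gaE; exact: inMN.
have eab : eps (al + be) = -1 by rewrite -[al + be]opprK epsN ?ega.
have egb : eps (- (al + be) + be) = -1 by rewrite gaE epsN// eal.
rewrite (NX _ _ Mal Mbe Mab eal ebe eab) (NX _ _ Mga Mbe Mgb ega ebe egb).
have Dn a b : inM a -> inM b -> inM (a + b) ->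
    D (lie (X a) (X b)) = lam (a + b) *: lie (X a) (X b).
  move=> Ma Mb Mc; rewrite (n_lie Ma.1 Mb.1 (root_neq0 Mc.1)) linearZZ /=.
  by rewrite (diag_X _ Mc.1) !scalerA mulrC.
rewrite !linearZZ /= (Dn _ _ Mal Mbe Mab) (Dn _ _ Mga Mbe Mgb) gaE.
rewrite (lamN g_inv Mal) !killingZr -mulrDr => /eqP.
(* Invariance of the Killing form makes the two pairings opposite, so the difference of the two
   factors multiplies a nonzero structure constant. *)
rewrite mulf_eq0 pnatr_eq0 /= [killing (X al) _]killingC killingA.
rewrite [lie (X be) _]lieC killingNr mulrN subr_eq0 => /eqP.
apply: mulIf; rewrite (n_lie Mal.1 Mbe.1 rab) killingZr killingC (killing_XN Mab.1).
by rewrite mulr1; exact: (n_real_neq0 Mal.1 Mbe.1 Mab.1).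
Qed.

End MetricRelations.

(* The roots in a level set of [mu] and their brackets span an ideal, which
   commutes with the root vectors of every other level set. *)
Lemma level_unique (mu : dual h -> R[i]) : simple_lie L ->
  (forall a, inM a -> mu (- a) = mu a) ->
  (forall a b, inT b -> inM a -> inM (b + a) -> mu (b + a) = mu a) ->
  (forall a b, inM a -> inM b -> inM (a + b) -> mu (a + b) = mu a) ->
  forall a b, inM a -> inM b -> mu a = mu b.
Proof.
move=> [_ L_simple] muN muT muM a0 b0 Ma0 Mb0; apply: contrapT => /eqP ab0.
pose P := [seq a <- rts | `[< inM a >] && (mu a == mu a0)].
have PP a : a \in P <-> inM a /\ mu a = mu a0.
  rewrite mem_filter -andbA; split=> [/and3P[/asboolP Ma /eqP ma _]//|[Ma ->]].
  by rewrite eqxx asboolT//=; apply/rtsP; case: Ma.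
pose V := <<[seq X a | a <- P]>>%VS.
have XV a : a \in P -> X a \in V by move=> aP; apply/memv_span/map_f.
have nXV r a b : is_root a -> is_root b -> (is_root (a + b) -> a + b \in P) ->
    r = (n a b)%:C -> r *: X (a + b) \in V.
  move=> ra rb Pab ->; have [rab|nr] := pselect (is_root (a + b)).
    exact/rpredZ/XV/Pab.
  by rewrite n_eq0// scale0r mem0v.
have VT c a : inT c -> a \in P -> lie (X c) (X a) \in V.
  move=> Tc /PP[Ma ma]; rewrite (n_lie Tc.1 Ma.1 (inTM_neq0 Tc Ma)).
  apply: (nXV _ _ _ Tc.1 Ma.1) => // r; have Mca := inMDT Tc Ma r.
  by apply/PP; rewrite muT.
have Vh v a : v \in h -> a \in P -> lie v (X a) \in V.
  by move=> hv aP; have [Ma _] := (PP a).1 aP; rewrite (X_weight Ma.1 hv) rpredZ// XV.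
have V0 c a : inM c -> mu c != mu a0 -> a \in P -> lie (X c) (X a) = 0.
  move=> Mc mc /PP[Ma ma]; have ca0 : c + a != 0.
    by apply: contraNneq mc => /eqP; rewrite addr_eq0 => /eqP ->; rewrite muN// ma.
  rewrite (n_lie Mc.1 Ma.1 ca0).
  have [r|nr] := pselect (is_root (c + a)); last first.
    by rewrite (n_eq0 Mc.1 Ma.1 nr) scale0r.
  (* If [c + a] is in $R_M$, its level is both [mu c] and [mu a]; if it is in $R_\Theta$, adding it
     to [- a] gives [c] without changing the level. *)
  move/negP: mc; case; apply/eqP; case: (root_MT r) => [Mca|Tca].
    by rewrite -ma -(muM _ _ Mc Ma Mca) addrC muM// addrC.
  by rewrite -ma -(muN _ Ma) -(muT _ _ Tca (inMN Ma)) addrK.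
pose I := <<[seq X a | a <- P] ++ [seq lie (X a) (X b) | a <- P, b <- P]>>%VS.
have VI : (V <= I)%VS by rewrite /I span_cat addvSl.
have XXI a b : a \in P -> b \in P -> lie (X a) (X b) \in I.
  move=> aP bP; apply: memv_span; rewrite mem_cat; apply/orP; right.
  by apply/allpairsP; exists (a, b).
have VVI x y : x \in V -> y \in V -> lie x y \in I.
  move=> xV yV; suff : (V <= linfun (lier y) @^-1: I)%VS.
    by move=> /subvP/(_ x xV); rewrite -memv_preim lfunE.
  apply/span_subvP => _ /mapP[a aP ->]; rewrite -memv_preim lfunE /= /lier.
  suff : (V <= ad (X a) @^-1: I)%VS.
    by move=> /subvP/(_ y yV); rewrite -memv_preim adE.
  by apply/span_subvP => _ /mapP[b bP ->]; rewrite -memv_preim adE XXI.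
have Xgen a y : a \in P -> lie (X a) y \in I.
  move=> aP; suff /subvP/(_ y (memvf y)) : (fullv <= ad (X a) @^-1: I)%VS.
    by rewrite -memv_preim adE.
  rewrite (@root_span_ind (ad (X a) @^-1: I)) ?subvv// => [|c rc].
    apply/subvP => v hv; rewrite -memv_preim adE lieC rpredN (subvP VI)//.
    exact: Vh.
  rewrite -memv_preim adE lieC rpredN.
  case: (root_MT rc) => [Mc|Tc]; last by rewrite (subvP VI)// VT.
  have [mc|mc] := eqVneq (mu c) (mu a0); last by rewrite V0// mem0v.
  by apply: XXI => //; exact/PP.
have XXgen a b y : a \in P -> b \in P -> lie (lie (X a) (X b)) y \in I.
  move=> aP bP; have jac z : lie (lie (X a) (X b)) z =
      - (lie (lie z (X a)) (X b) + lie (X a) (lie z (X b))).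
    by rewrite -lie_lier lieC.
  have [[Ma ma] [Mb mb]] := ((PP a).1 aP, (PP b).1 bP).
  suff /subvP/(_ y (memvf y)) : (fullv <= ad (lie (X a) (X b)) @^-1: I)%VS.
    by rewrite -memv_preim adE.
  rewrite (@root_span_ind (ad (lie (X a) (X b)) @^-1: I)) ?subvv// => [|c rc].
    apply/subvP => v hv; rewrite -memv_preim adE jac rpredN.
    by rewrite rpredD// VVI// ?XV// Vh.
  rewrite -memv_preim adE.
  case: (root_MT rc) => [Mc|Tc]; last first.
    by rewrite jac rpredN rpredD// VVI// ?XV// VT.
  have [mc|mc] := eqVneq (mu c) (mu a0); last first.
    by rewrite jac !V0// lie0l lie0r addr0 oppr0 mem0v.
  have cP : c \in P by exact/PP.
  (* Here the Jacobi identity would only yield triple brackets. Instead, [lie (X a) (X b)] is in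
     [h], or zero, or a multiple of a root vector from $R_\Theta$ or from [P], and each of these
     sends [X c] into [I]. *)
  have [ab|ab] := eqVneq (a + b) 0.
    have -> : b = - a by apply/eqP; rewrite -addr_eq0 addrC ab.
    by rewrite (subvP VI)// Vh//; exact: coroot_in Ma.1.
  rewrite (n_lie Ma.1 Mb.1 ab) lieZl.
  have [r|nr] := pselect (is_root (a + b)); last first.
    by rewrite (n_eq0 Ma.1 Mb.1 nr) scale0r mem0v.
  apply: rpredZ; case: (root_MT r) => [Mab|Tab]; last by rewrite (subvP VI)// VT.
  by apply: XXI => //; apply/PP; rewrite muM.
have idealI : lie_ideal I.
  move=> y x xI; rewrite lieC rpredN; suff : (I <= linfun (lier y) @^-1: I)%VS.
    by move=> /subvP/(_ x xI); rewrite -memv_preim lfunE.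
  apply/span_subvP => z; rewrite mem_cat -memv_preim lfunE /= /lier.
  case/orP => [/mapP[a aP ->]|/allpairsP[[a b] /= [aP bP ->]]]; first exact: Xgen.
  exact: XXgen.
have a0P : a0 \in P by exact/PP.
case: (L_simple I idealI) => [I0|IL].
  have : X a0 \in I by rewrite (subvP VI)// XV.
  by rewrite I0 memv0 (negPf (X_neq0 Ma0.1)).
(* Now [I] is all of [L], so [X b0], which commutes with [I], is central; yet some element of [h]
   acts on it by a nonzero scalar. *)
have mb0 : mu b0 != mu a0 by rewrite eq_sym.
have central y : lie (X b0) y = 0.
  suff /subvP/(_ y) : (I <= lker (ad (X b0)))%VS.
    by rewrite IL memvf memv_ker adE => /(_ isT)/eqP.
  apply/span_subvP => z; rewrite mem_cat memv_ker adE.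
  case/orP => [/mapP[a aP ->]|/allpairsP[[a b] /= [aP bP ->]]].
    by rewrite V0.
  by rewrite lie_lier !V0// lie0l lie0r addr0.
have [v hv bv] := dual_neq0 (root_neq0 Mb0.1).
have := X_weight Mb0.1 hv; rewrite lieC central oppr0 => /esym/eqP.
by rewrite scaler_eq0 (negPf bv) (negPf (X_neq0 Mb0.1)).
Qed.

Lemma G1_iff_normal (g : L -> L -> R) : simple_lie L ->
  invariant_metric S Theta X g ->
  (forall J : L -> L, invariant_acs S Theta X J -> G1_structure S Theta X g J) <->
  normal_metric S Theta X g.
Proof.
move=> simpleL g_inv; split=> [G1|gN J J_inv]; last exact: normal_G1.
have lam_const a b : inM a -> inM b -> lam g a = lam g b.
  apply: level_unique => //; first exact: lamN.
    exact: lam_T.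
  by move=> c d; exact: lam_M.
(* If $R_M$ is empty, [m_Theta] is zero and any positive constant serves. *)
have [[a0 Ma0]|noM] := pselect (exists a, inM a); last first.
  exists 1 => // x y mx my.
  suff x0 z : mm z -> z = 0.
    by rewrite (metric_diag g_inv mx my) (x0 x mx) linear0 !killing0l mulr0.
  move=> mz; apply: (m_linear_eq0 (f := idfun)) mz => a Ma.
  by case: noM; exists a.
have lam0 := lam_gt0 g_inv Ma0.
exists (g (rA a0) (rA a0) / 2); first by move: lam0; rewrite /lam ltcR.
move=> x y mx my; rewrite (metric_diag g_inv mx my); congr (- _).
rewrite -/(lam g a0).
have -> : diag (lam g) x = lam g a0 *: x.
  pose F : {linear L -> L} := GRing.scale_fun (lam g a0) idfun.
  apply: (diag_linear_eq (F := F)) mx => a Ma.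
  by rewrite /F /= (lam_const a a0).
by rewrite killingZl.
Qed.

End Roots.

Theorem theorem7p6 (R : realType) (L : lieAlgType R[i])
    (L_simple : simple_lie L)
    (h : {vspace L}) (h_cartan : cartan_subalgebra h)
    (S Theta : seq (dual h)) (S_simple : simple_system S)
    (sTheta : {subset Theta <= S})
    (X : dual h -> L) (X_weyl : weyl_basis X)
    (g : L -> L -> R) (g_inv : invariant_metric S Theta X g) :
  (forall J : L -> L, invariant_acs S Theta X J ->
     G1_structure S Theta X g J) <->
  normal_metric S Theta X g.
Proof.
have [rts [rts_uniq [rtsP _]]] := rootsP X_weyl.
have [_ _ [n nP] _] := X_weyl.
have n_lie a b : is_root a -> is_root b -> a + b != 0 ->
  lie (X a) (X b) = (n a b)%:C *: X (a + b) by move=> ra rb; case: (nP a b ra rb).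
have n_neq0 a b : is_root a -> is_root b -> n a b != 0 <-> is_root (a + b).
  by move=> ra rb; case: (nP a b ra rb).
have nNN a b : is_root a -> is_root b -> n (- a) (- b) = - n a b.
  by move=> ra rb; case: (nP a b ra rb) => _ _ ->; rewrite opprK.
exact: (G1_iff_normal h_cartan S_simple X_weyl n_lie n_neq0 nNN sTheta rts_uniq rtsP
  L_simple g_inv).
Qed.
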